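(* Let $X$ be a real separable Hilbert space and let $\{U(t,s)\}_{s\le t}$, $\{B(t)\}_{t\in\mathbb R}$ satisfy assumptions (A1)--(A4) of the context. The following statements hold for every $s<t$. (i) $\mathcal H_{t,s}\subseteq\mathcal H_t$ with continuous embedding of norm smaller than or equal to $1$, and $\ker(Q(t,-\infty)^{1/2})\subseteq\ker(Q(t,s)^{1/2})$; moreover, when $r\mapsto B(r)$ is strongly continuous, $\ker(Q(t,s)^{1/2})\subseteq\ker(Q(t))$. (ii) $U(t,s)$ maps $\mathcal H_s$ into $\mathcal H_t$ and $$\|U(t,s)\|_{\mathscr L(\mathcal H_s,\mathcal H_t)}=\|Q(t,-\infty)^{-1/2}U(t,s)Q(s,-\infty)^{1/2}\|_{\mathscr L(X)}\le1.$$ (iii) $\mathcal H_t\subseteq\mathcal H_{t,s}$ if and only if $$\|U(t,s)\|_{\mathscr L(\mathcal H_s,\mathcal H_t)}=\|Q(t,-\infty)^{-1/2}U(t,s)Q(s,-\infty)^{1/2}\|_{\mathscr L(X)}<1.$$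
   Context: Assumptions. (A1) $\{U(t,s)\}_{s\le t}\subseteq\mathscr L(X)$ is a strongly continuous evolution operator: $(s,t)\mapsto U(t,s)x$ is continuous for every $x\in X$, $U(t,t)=I$ and $U(t,r)U(r,s)=U(t,s)$ for $s\le r\le t$. (A2) $\{B(t)\}_{t\in\mathbb R}\subseteq\mathscr L(X)$, $\sup_{t}\|B(t)\|_{\mathscr L(X)}<\infty$, and $t\mapsto B(t)x$ is measurable for every $x\in X$. (A3) With $Q(r):=B(r)B(r)^\star$, for every $s<t$ the operator $Q(t,s)=\int_s^tU(t,r)Q(r)U(t,r)^\star\,dr$ has finite trace. (A4) For every $t\in\mathbb R$, $\sup_{s<t}\mathrm{Tr}[Q(t,s)]<\infty$, and $\lim_{s\to-\infty}U(t,s)x=0$ for every $x\in X$. $Q(t,-\infty):=\int_{-\infty}^tU(t,r)Q(r)U(t,r)^\star\,dr$ (a trace class operator). For a self-adjoint non-negative $Q\in\mathscr L(X)$, $Q^{-1/2}$ denotes the pseudo-inverse of $Q^{1/2}$, defined on $Q^{1/2}(X)$: $Q^{-1/2}h$ is the unique $z\in(\ker Q^{1/2})^\perp$ with $Q^{1/2}z=h$; $Q^{1/2}(X)$ is a Hilbert space with norm $\|h\|=\|Q^{-1/2}h\|_X$. $\mathcal H_{t,s}=Q(t,s)^{1/2}(X)$ and $\mathcal H_t=Q(t,-\infty)^{1/2}(X)$ are endowed with these norms (they are the Cameron–Martin spaces of $\mathcal N(0,Q(t,s))$ and $\mathcal N(0,Q(t,-\infty))$). *)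

(* Defs.v *)
From HB Require Import structures.
From mathcomp Require Import all_boot all_order all_algebra.
From mathcomp Require Import all_classical all_reals all_analysis.
Import Order.TTheory GRing.Theory Num.Theory.
Import numFieldNormedType.Exports.

Set Implicit Arguments.
Unset Strict Implicit.
Unset Printing Implicit Defensive.

Local Open Scope classical_set_scope.
Local Open Scope ring_scope.

Definition separable_space (T : topologicalType) : Prop :=
  exists2 D : set T, countable D & dense D.

Section operators.
Context {R : realType} {X : completeNormedModType R}.
Implicit Types (A S T : X -> X) (x y z h : X).

Definition bounded_op A : Prop := linear A /\ continuous A.

Definition op_ker A : set X := [set x | A x = 0].

(* Norm of [T] as an operator from the subspace [E], normed by [n1], to a
   space normed by [n2]; the value is [+oo] when [T] is not bounded. *)
Definition opnorm_on (E : set X) (n1 n2 : X -> R) T : \bar R :=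
  ereal_sup [set (n2 (T h))%:E | h in [set h | E h /\ n1 h <= 1]].

Definition opnorm T : \bar R := opnorm_on setT Num.norm Num.norm T.

(* Bochner integral over [D] with respect to the Lebesgue measure.  Each [s n]
   below is an integrable simple function; the value [0] may be taken on a set
   of infinite measure, and it does not contribute to [simple_integral]. *)
Definition integrable_simple (D : set R) (s : R -> X) : Prop :=
  finite_set (range s) /\
  forall v, measurable (s @^-1` [set v] : set (measurableTypeR R)) /\
    (v != 0 -> (lebesgue_measure (D `&` s @^-1` [set v]) < +oo)%E).

Definition simple_integral (D : set R) (s : R -> X) : X :=
  \sum_(v \in range s) fine (lebesgue_measure (D `&` s @^-1` [set v])) *: v.

Definition is_bochner_integral (D : set R) (f : R -> X) (v : X) : Prop :=
  exists s : nat -> R -> X,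
    [/\ forall n, integrable_simple D (s n),
        forall r, D r -> s n r @[n --> \oo] --> f r,
        (\int[lebesgue_measure]_(r in D) (`|f r - s n r|)%:E)%E
          @[n --> \oo] --> 0%E
      & simple_integral D (s n) @[n --> \oo] --> v].

Definition bochner_integral (D : set R) (f : R -> X) : X :=
  get (is_bochner_integral D f).

(* The map [U t s] is only meaningful for [s <= t]. *)
Definition evolution_operator (U : R -> R -> X -> X) : Prop :=
  [/\ forall s t, s <= t -> bounded_op (U t s),
      forall x, {within [set p : R * R | p.1 <= p.2],
                   continuous (fun p : R * R => U p.2 p.1 x)},
      forall t, U t t = id
    & forall s r t, s <= r -> r <= t -> U t r \o U r s = U t s].

Definition strongly_measurable (B : R -> X -> X) : Prop :=
  forall x, measurable_fun setT
    (fun t : measurableTypeR R => B t x : g_sigma_algebraType (@open X)).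

Definition strongly_continuous (B : R -> X -> X) : Prop :=
  forall x, continuous (fun t => B t x).

(* The inner product is a parameter, to be used with the hypothesis that it
   induces the norm of [X]. *)
Variable ip : {dot X for @idfun R}.

Definition op_adjoint A : X -> X :=
  fun y => get [set z | forall x, ip (A x) y = ip x z].

Definition nonneg_selfadjoint A : Prop :=
  [/\ bounded_op A, forall x y, ip (A x) y = ip x (A y)
    & forall x, 0 <= ip (A x) x].

Definition sqrt_op A : X -> X :=
  get [set S | nonneg_selfadjoint S /\ S \o S = A].

Definition pseudo_inv S : X -> X :=
  fun h => get [set z | (forall k, op_ker S k -> ip z k = 0) /\ S z = h].

Definition orthonormal_basis (E : set X) : Prop :=
  (forall e e', E e -> E e' -> ip e e' = (e == e')%:R) /\
  (forall x, (forall e, E e -> ip x e = 0) -> x = 0).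

(* Meant for non-negative operators, for which the sum does not depend on the
   orthonormal basis. *)
Definition op_trace A : \bar R :=
  \esum_(e in get orthonormal_basis) (ip (A e) e)%:E.

(* The range of the square root of [A] as a Hilbert space: carrier and norm. *)
Definition cm_space A : set X := range (sqrt_op A).
Definition cm_norm A : X -> R := fun h => `|pseudo_inv (sqrt_op A) h|.

Definition Qop (B : R -> X -> X) (r : R) : X -> X := B r \o op_adjoint (B r).

(* The operator-valued integrals are taken in the strong sense. *)
Definition Qint (U : R -> R -> X -> X) (B : R -> X -> X) (D : set R) (t : R)
    : X -> X :=
  fun x => bochner_integral D
    (fun r => (U t r \o Qop B r \o op_adjoint (U t r)) x).

Definition Qfin U B t s : X -> X := Qint U B `[s, t] t.
Definition Qinf U B t : X -> X := Qint U B `]-oo, t] t.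

End operators.

(* Main.v *)
(* With [S_t], [S_ts], [S_s] the square roots of [Q(t,-oo)], [Q(t,s)], [Q(s,-oo)],
   splitting the integral over ]-oo, t] at [s] gives
   [Q(t,-oo) = Q(t,s) + U(t,s) Q(s,-oo) U(t,s)^*], that is
   [|S_t x|^2 = |S_ts x|^2 + |S_s U(t,s)^* x|^2] for all [x].  By Douglas' lemma,
   [|T^* x| <= c |S x|] for all [x] iff [T] maps into the range of [S] with
   [|S^-1 T| <= c]; taking for [T] the operators [S_ts] and [U(t,s) S_s] gives (i)
   and (ii).  For (iii), both sides amount to a bound [|S_t x| <= K |S_ts x|], which
   follows from the range inclusion by uniform boundedness.
   The integral over ]-oo, t] converges because [|L L^* x| <= tr |x|] with
   [L = U(t,r) B(r)] and [tr] the trace of [L L^*], whose integral is a supremum of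
   traces of [Q(t,s)]. *)
From HB Require Import structures.
Require Import Defs.
From mathcomp Require Import all_boot all_order all_algebra.
From mathcomp Require Import all_classical all_reals all_analysis.
From mathcomp Require Import measurable_realfun.
From mathcomp Require Import ring lra.
Import Order.TTheory GRing.Theory Num.Theory.
Import numFieldNormedType.Exports.

Local Open Scope classical_set_scope.
Local Open Scope ring_scope.

(** Adjoints, square roots, pseudo-inverses, integrals and the basis behind the trace are all picked
    by [get], so each becomes usable only once existence is proved; this accounts for most of the
    development. One variational representation lemma serves three times: it yields adjoints, the
    preimage in Douglas' lemma and the value of a Bochner integral. The operators depend on [r] only
    strongly, and taking adjoints can destroy strong continuity, so measurability and the limit
    [r -> t] in the kernel inclusion are handled through inner products with fixed vectors. In
    (iii), a norm [c < 1] gives [|S_s U(t,s)^* x| <= c |S_t x|], hence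
    [(1 - c^2) |S_t x|^2 <= |S_ts x|^2]; conversely [|S_t x| <= K |S_ts x|] gives [|S_ts x|^2] a
    share of at least [K^-2] in the splitting, which keeps the other share away from 1. *)

Section linear_functions.
Context {R : realType} {X Y : normedModType R}.
Implicit Types A : X -> Y.

Definition pack_linear A (A_lin : linear A) : {linear X -> Y} :=
  HB.pack A (GRing.isLinear.Build _ _ _ _ _ A_lin).

Lemma lin0 A : linear A -> A 0 = 0.
Proof. by move=> hA; exact: (linear0 (pack_linear A hA)). Qed.

Lemma linD A : linear A -> {morph A : x y / x + y}.
Proof. by move=> hA; exact: (linearD (pack_linear A hA)). Qed.

Lemma linB A : linear A -> {morph A : x y / x - y}.
Proof. by move=> hA; exact: (linearB (pack_linear A hA)). Qed.

Lemma linZ A : linear A -> forall a, {morph A : x / a *: x}.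
Proof. by move=> hA; exact: (linearZ_LR (pack_linear A hA)). Qed.

Lemma lin_sum A : linear A ->
  forall (I : Type) (r : seq I) (P : pred I) (F : I -> X),
  A (\sum_(i <- r | P i) F i) = \sum_(i <- r | P i) A (F i).
Proof. by move=> hA I r P F; exact: (linear_sum (pack_linear A hA)). Qed.

Lemma bounded_linear_continuous_fun A : linear A ->
  (exists C, forall x, `|A x| <= C * `|x|) -> continuous A.
Proof.
move=> hA [C AC]; apply: (@bounded_linear_continuous _ _ _ (pack_linear A hA)).
apply/linear_boundedP; near=> M => x /=.
by rewrite (le_trans (AC x))// ler_wpM2r.
Unshelve. all: by end_near. Qed.

Lemma linear_continuous_bound A : linear A -> continuous A ->
  exists2 C, 0 < C & forall x, `|A x| <= C * `|x|.
Proof.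
move=> hA Ac.
have /linear_boundedP := @continuous_linear_bounded _ _ _ 0 (pack_linear A hA) (Ac 0).
rewrite /= nearE/= => -[M [Mr]] /(_ (Num.max 1 (M + 1))) AM.
exists (Num.max 1 (M + 1)); first by rewrite lt_max ltr01.
by apply: AM; rewrite lt_max ltrDl ltr01 orbT.
Qed.

End linear_functions.

(** * Hilbert spaces and pseudo-inverses *)

Section hilbert.
Context {R : realType} {X : completeNormedModType R}.
Context (ip : {dot X for @idfun R}).
Context (ip_norm : forall x : X, ip x x = `|x| ^+ 2).
Implicit Types (x y z : X) (a : R).

Lemma ipC x y : ip x y = ip y x.
Proof. by rewrite hermC expr0 mul1r. Qed.

Lemma ipDl x y z : ip (x + y) z = ip x z + ip y z.
Proof. exact: linearDl. Qed.

Lemma ipBl x y z : ip (x - y) z = ip x z - ip y z.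
Proof. exact: linearBl. Qed.

Lemma ipZl a x y : ip (a *: x) y = a * ip x y.
Proof. by rewrite linearZl_LR. Qed.

Lemma ip0l y : ip 0 y = 0. Proof. exact: linear0l. Qed.

Lemma ipDr x y z : ip z (x + y) = ip z x + ip z y.
Proof. by rewrite ipC ipDl !(ipC z). Qed.

Lemma ipBr x y z : ip z (x - y) = ip z x - ip z y.
Proof. by rewrite ipC ipBl !(ipC z). Qed.

Lemma ipZr a x y : ip y (a *: x) = a * ip y x.
Proof. by rewrite ipC ipZl (ipC y). Qed.

Lemma ip0r y : ip y 0 = 0. Proof. by rewrite ipC ip0l. Qed.

Lemma ip_suml (I : Type) (r : seq I) (P : pred I) (F : I -> X) y :
  ip (\sum_(i <- r | P i) F i) y = \sum_(i <- r | P i) ip (F i) y.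
Proof.
by elim/big_rec2: _ => [|i u v _ <-]; [exact: ip0l|rewrite ipDl].
Qed.

Lemma ip_ext x y : (forall z, ip x z = ip y z) -> x = y.
Proof.
move=> xy; apply/eqP; rewrite -subr_eq0 -normr_eq0 -sqrf_eq0 -ip_norm.
by rewrite ipBl xy subrr.
Qed.

Lemma normD_sqr x y : `|x + y| ^+ 2 = `|x| ^+ 2 + 2 * ip x y + `|y| ^+ 2.
Proof. by rewrite -!ip_norm ipDl !ipDr (ipC y x); ring. Qed.

Lemma normB_sqr x y : `|x - y| ^+ 2 = `|x| ^+ 2 - 2 * ip x y + `|y| ^+ 2.
Proof. by rewrite -!ip_norm ipBl !ipBr (ipC y x); ring. Qed.

(** The discriminant criterion behind both Cauchy-Schwarz for semidefinite forms and the approximate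
    Euler equation of a minimizing sequence. *)
Lemma sqr_le_disc (p b q : R) : 0 <= q ->
  (forall e, 0 <= p + 2 * e * b + e ^+ 2 * q) -> b ^+ 2 <= p * q.
Proof.
rewrite le_eqVlt => /orP[/eqP <- h|q0 /(_ (- b / q))].
  have [->|b0] := eqVneq b 0; first by rewrite mulr0 expr0n.
  (* For [q = 0] the polynomial is affine; this [e] would give it the value -1, so [b] must
     vanish. *)
  have := h (- (p + 1) / (2 * b)); rewrite mulr0 addr0.
  suff -> : 2 * (- (p + 1) / (2 * b)) * b = - (p + 1) by lra.
  by field; rewrite b0.
have -> : p + 2 * (- b / q) * b + (- b / q) ^+ 2 * q = (p * q - b ^+ 2) / q.
  by field; exact: lt0r_neq0.
by rewrite pmulr_lge0 ?invr_gt0// subr_ge0.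
Qed.

Lemma nonneg_cauchy_schwarz (A : X -> X) : linear A ->
  (forall x y, ip (A x) y = ip x (A y)) -> (forall x, 0 <= ip (A x) x) ->
  forall x y, ip (A x) y ^+ 2 <= ip (A x) x * ip (A y) y.
Proof.
move=> Al As An x y; apply: sqr_le_disc => // e.
have := An (x + e *: y).
rewrite (linD _ Al) (linZ _ Al) !ipDl !ipDr !ipZl !ipZr (As y x) (ipC y).
by move/le_trans; apply; rewrite le_eqVlt; apply/orP; left; apply/eqP; ring.
Qed.

Lemma cauchy_schwarz x y : `|ip x y| <= `|x| * `|y|.
Proof.
rewrite -(@ler_pXn2r _ 2) ?nnegrE ?mulr_ge0// real_normK ?num_real//.
rewrite exprMn -!ip_norm; apply: (@nonneg_cauchy_schwarz idfun) => // z.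
by rewrite ip_norm sqr_ge0.
Qed.

Lemma ip_le_norm x y : ip x y <= `|x| * `|y|.
Proof. exact: le_trans (ler_norm _) (cauchy_schwarz x y). Qed.

Lemma norm_le_of_ip x c : 0 <= c -> ip x x <= c * `|x| -> `|x| <= c.
Proof.
move=> c0; rewrite ip_norm expr2.
have [->|x0] := eqVneq `|x| 0; first by [].
by rewrite ler_pM2r// lt0r x0 normr_ge0.
Qed.

Lemma cvg_ipl {T : Type} {F : set_system T} {FF : Filter F} {u : T -> X} {x} y :
  u t @[t --> F] --> x -> ip (u t) y @[t --> F] --> ip x y.
Proof.
have : continuous ((fun z => ip z y) : X -> R^o).
  apply: (@bounded_linear_continuous_fun R X R^o (fun z => ip z y)) => [a u' v|].
    by rewrite ipDl ipZl.
  by exists `|y| => z; rewrite mulrC cauchy_schwarz.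
by move=> /(_ x) h ux; exact: (cvg_comp _ _ ux h).
Qed.

Lemma cauchy_bound_cvg (u : nat -> X) (d : nat -> R) : d @ \oo --> 0 ->
  (forall n m, (n <= m)%N -> `|u m - u n| <= d n) -> exists l : X, u @ \oo --> l.
Proof.
move=> d0 ud; apply/cvg_ex/cauchy_cvgP/cauchy_exP => e e0.
have [N _ dN] : \forall n \near \oo, `|d n| < e.
  by move/cvgr0Pnorm_lt : d0 => /(_ _ e0).
exists (u N); exists N => // m /= Nm.
rewrite -ball_normE/= distrC (le_lt_trans (ud _ _ Nm))//.
by rewrite (le_lt_trans (ler_norm _))// dN/=.
Qed.

Lemma norm_le_of_cvg {u : nat -> X} {x} {C : R} :
  u @ \oo --> x -> (forall n, `|u n| <= C) -> `|x| <= C.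
Proof.
move=> ux uC; have h : `|u n| @[n --> \oo] --> `|x| by exact: cvg_norm.
by rewrite -(cvg_lim _ h)//; apply: limr_le; [exact: (cvgP _ h)|exact: nearW].
Qed.

Lemma cvg_of_dist_le {V : normedModType R} {u : nat -> V} {d : nat -> R} {l : V} :
  d @ \oo --> 0 -> (forall n, `|u n - l| <= d n) -> u @ \oo --> l.
Proof.
move=> d0 ud; apply/cvgrPdist_le => e e0; move/cvgr0Pnorm_le : d0 => /(_ _ e0).
apply: filterS => n; apply: le_trans; rewrite distrC.
exact: le_trans (ud n) (ler_norm _).
Qed.

Lemma eq_of_cvg_dist {u d : nat -> R} {a b : R} :
  u @ \oo --> a -> d @ \oo --> 0 -> (forall n, `|u n - b| <= d n) -> a = b.
Proof.
move=> ua d0 ud; exact: (cvg_unique _ ua (cvg_of_dist_le d0 ud)).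
Qed.

(* Minimize [|T x|^2 - 2 phi x]: along a minimizing sequence, [T x] converges
   by the parallelogram identity. *)
Lemma functional_representation (T : X -> X) (phi : X -> R) (c : R) :
  linear T -> scalar phi -> 0 <= c -> (forall x, `|phi x| <= c * `|T x|) ->
  exists w, [/\ forall x, ip w (T x) = phi x, `|w| <= c
    & forall k, (forall x, ip (T x) k = 0) -> ip w k = 0].
Proof.
move=> Tl phil c0 phic.
have phiD x y : phi (x + y) = phi x + phi y.
  by have := phil 1 x y; rewrite scale1r mul1r.
have phi0 : phi 0 = 0 by have := phiD 0 0; rewrite addr0; lra.
have phiZ a x : phi (a *: x) = a * phi x.
  by have := phil a x 0; rewrite phi0 !addr0.
pose J x := `|T x| ^+ 2 - 2 * phi x.
have Jlb x : - c ^+ 2 <= J x.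
  have := ler_norm (phi x); have := phic x; rewrite /J.
  have := sqr_ge0 (c - `|T x|); rewrite sqrrB.
  set p := `|phi x|; set t := `|T x|; nra.
have J_inf : has_inf (range J).
  by split; [exists (J 0); exists 0|exists (- c ^+ 2) => _ [x _ <-]].
pose m := inf (range J).
have mJ x : m <= J x by apply: ge_inf; [exact: J_inf.2|exists x].
(* The tolerance is squared because the two estimates that use it, the Cauchy bound and [euler],
   control squares of norms. *)
have /choice[x_ x_m] n : exists x, J x <= m + (harmonic n : R) ^+ 2.
  have h0 : 0 < (harmonic n : R) ^+ 2 by rewrite exprn_gt0// invr_gt0.
  have [_ [x _ <-] /ltW Jx] := inf_adherent h0 J_inf.
  by exists x.
have [w Tw] : exists w : X, T (x_ n) @[n --> \oo] --> w.
  apply: (@cauchy_bound_cvg _ (fun n => 2 * harmonic n)).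
    by rewrite -(mulr0 2); apply: cvgM; [exact: cvg_cst|exact: cvg_harmonic].
  move=> i j ij.
  rewrite -(@ler_pXn2r _ 2)// ?nnegrE ?mulr_ge0 ?invr_ge0//.
  have hij : (harmonic j : R) ^+ 2 <= (harmonic i : R) ^+ 2.
    by rewrite ler_pXn2r ?nnegrE ?invr_ge0// lef_pV2 ?posrE// ler_nat.
  have := mJ (2^-1 *: (x_ j + x_ i)); have := x_m i; have := x_m j.
  rewrite /J (linZ _ Tl) (linD _ Tl) phiZ phiD normrZ exprMn normB_sqr normD_sqr.
  rewrite ger0_norm// exprMn; nra.
(* [J (x_ n + e *: y)] is at least [m], hence at least [J (x_ n)] minus the tolerance, for every
   [e]: a non-negative quadratic polynomial in [e], whose discriminant gives the bound. *)
have euler n y : `|ip (T (x_ n)) (T y) - phi y| <= harmonic n * `|T y|.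
  rewrite -(@ler_pXn2r _ 2) ?nnegrE ?mulr_ge0 ?invr_ge0//.
  rewrite real_normK ?num_real// exprMn; apply: sqr_le_disc => // e.
  have := mJ (x_ n + e *: y); have := x_m n.
  rewrite /J (linD _ Tl) (linZ _ Tl) phiD phiZ normD_sqr normrZ exprMn ipZr.
  rewrite real_normK ?num_real//; nra.
have wE y : ip w (T y) = phi y.
  have h : ip (T (x_ n)) (T y) @[n --> \oo] --> ip w (T y) by exact: cvg_ipl.
  apply: (eq_of_cvg_dist h _ (euler^~ y)).
  by rewrite -(mul0r `|T y|); apply: cvgM; [exact: cvg_harmonic|exact: cvg_cst].
exists w; split => //.
- apply: norm_le_of_ip => //.
  have h1 : ip (T (x_ n)) w @[n --> \oo] --> ip w w by exact: cvg_ipl.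
  have h2 : c * `|T (x_ n)| @[n --> \oo] --> c * `|w|.
    by apply: cvgM; [exact: cvg_cst|exact: cvg_norm].
  apply: (ler_cvg_to h1 h2); apply: nearW => n.
  by rewrite ipC wE (le_trans (ler_norm _)).
- move=> k Tk.
  have h : ip (T (x_ n)) k @[n --> \oo] --> ip w k by exact: cvg_ipl.
  apply: (eq_of_cvg_dist h (cvg_cst 0)) => n.
  by rewrite Tk subr0 normr0.
Qed.

Definition is_adjoint (A A' : X -> X) := forall x y, ip (A x) y = ip x (A' y).

Lemma op_adjointP {A} : bounded_op A -> is_adjoint A (op_adjoint ip A).
Proof.
move=> [Al Ac] x y; have [C C0 AC] := linear_continuous_bound A Al Ac.
suff : exists z, forall x, ip (A x) y = ip x z by move=> /getPex; exact.
have [|||z|w [wE _ _]] :=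
    @functional_representation id (fun x => ip (A x) y) (C * `|y|).
- by [].
- by move=> a u v; rewrite linD// linZ// ipDl ipZl.
- by rewrite mulr_ge0// ltW.
- rewrite (le_trans (cauchy_schwarz _ _))// mulrAC.
  by rewrite ler_wpM2r.
- by exists w => z; rewrite (ipC z) (wE z).
Qed.

Lemma is_adjoint_linear {A A'} : is_adjoint A A' -> linear A'.
Proof.
move=> AA' a u v; apply: ip_ext => z.
by rewrite ipC -AA' ipDl ipZl ipDr ipZr !AA' !(ipC z).
Qed.

Lemma is_adjoint_norm {A A' C} : 0 <= C -> is_adjoint A A' ->
  (forall x, `|A x| <= C * `|x|) -> forall y, `|A' y| <= C * `|y|.
Proof.
move=> C0 AA' AC y; apply: norm_le_of_ip; first by rewrite mulr_ge0.
rewrite -AA' (le_trans (ip_le_norm _ _))// mulrAC ler_wpM2r//.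
Qed.

Lemma is_adjoint_unique {A A1 A2} : is_adjoint A A1 -> is_adjoint A A2 -> A1 =1 A2.
Proof.
by move=> h1 h2 y; apply: ip_ext => z; rewrite ipC -h1 h2 ipC.
Qed.

Lemma is_adjoint_comp {A1 A1' A2 A2'} : is_adjoint A1 A1' -> is_adjoint A2 A2' ->
  is_adjoint (A1 \o A2) (A2' \o A1').
Proof. by move=> h1 h2 x y; rewrite /= h1 h2. Qed.

(* Douglas' range inclusion, for one vector. *)
Lemma pseudo_inv_exists S h c : nonneg_selfadjoint ip S -> 0 <= c ->
  (forall x, `|ip h x| <= c * `|S x|) ->
  S (pseudo_inv ip S h) = h /\ `|pseudo_inv ip S h| <= c.
Proof.
move=> [[Sl Sc] Ss _] c0 hc.
have [|||z|w [wE wc wk]] := @functional_representation S (ip h) c.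
- exact: Sl.
- by move=> a u v; rewrite ipDr ipZr.
- exact: c0.
- exact: hc.
have Sw : S w = h by apply: ip_ext => z; rewrite Ss wE.
have [kP SP] : [set z | (forall k, op_ker S k -> ip z k = 0) /\ S z = h]
    (pseudo_inv ip S h).
  apply: getPex; exists w; split => // k Sk; apply: wk => x.
  by rewrite Ss Sk ip0r.
split=> //; suff -> : pseudo_inv ip S h = w by [].
apply/eqP; rewrite -subr_eq0 -normr_eq0 -sqrf_eq0 -ip_norm.
have Sk : op_ker S (pseudo_inv ip S h - w).
  by rewrite /op_ker/= (linB _ Sl) SP Sw subrr.
rewrite ipBl (kP _ Sk) wk ?subr0// => x.
by rewrite Ss Sk ip0r.
Qed.

Lemma pseudo_inv_apply S z : nonneg_selfadjoint ip S ->
  S (pseudo_inv ip S (S z)) = S z /\ `|pseudo_inv ip S (S z)| <= `|z|.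
Proof.
move=> hS; apply: pseudo_inv_exists => // x.
by case: hS => _ -> _; exact: cauchy_schwarz.
Qed.

(** Weakly bounded sets are norm bounded: Banach-Steinhaus for the functionals [ip f], each of which
    reaches its norm at [f / |f|]. *)
Lemma ip_uniform_bound (F : set X) :
  (forall y, exists C, forall f, F f -> `|ip f y| <= C) ->
  exists2 C, 0 < C & forall f, F f -> `|f| <= C.
Proof.
move=> Fb; pose G := [set (fun y => ip f y : R^o) | f in F].
have [||M GM] := @Banach_Steinhauss R X R^o G _ _ 1.
- move=> _ [f Ff <-]; split.
    move=> r; exists (`|f| * r) => x xr.
    by rewrite (le_trans (cauchy_schwarz _ _))// ler_wpM2l.
  by move=> a u v; rewrite ipDr ipZr.
- by move=> y; have [C FC] := Fb y; exists C => _ [f Ff <-]; exact: FC.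
exists (Num.max 1 M) => [|f Ff]; first by rewrite lt_max ltr01.
have [->|f0] := eqVneq f 0; first by rewrite normr0 le_max ler01.
rewrite le_max; apply/orP; right.
have := GM _ (imageP _ Ff) (`|f|^-1 *: f).
rewrite normrZ normfV normr_id mulVf ?normr_eq0// ipZr ip_norm => /(_ (lexx _)).
by rewrite expr2 mulKf ?normr_eq0// normr_id.
Qed.

(* Hellinger-Toeplitz *)
Lemma symmetric_bounded A : linear A ->
  (forall x y, ip (A x) y = ip x (A y)) -> bounded_op A.
Proof.
move=> Al As; split => //; apply: bounded_linear_continuous_fun => //.
have [|C C0 AC] := @ip_uniform_bound (A @` [set x | `|x| <= 1]).
  move=> y; exists `|A y| => _ [x /= x1 <-].
  rewrite As (le_trans (cauchy_schwarz _ _))//.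
  by rewrite ler_piMl.
exists C => x; have [->|x0] := eqVneq x 0; first by rewrite lin0// !normr0 mulr0.
have := AC (A (`|x|^-1 *: x)); rewrite linZ// normrZ normfV normr_id.
rewrite ler_pdivrMl ?normr_gt0// mulrC; apply.
exists (`|x|^-1 *: x); last by rewrite linZ.
by rewrite /= normrZ normfV normr_id mulVf ?normr_eq0.
Qed.

(** * Square roots *)

(* For [Y = lim Y_n], [Y_(n+1) = (P + Y_n^2) / 2], the operator [1 - Y] is a
   square root of [1 - P]; the scalar iteration at [P = 1] dominates the increments. *)
Fixpoint sqrt_iter (P : X -> X) (n : nat) : X -> X :=
  if n is n'.+1 then fun x => 2^-1 *: (P x + sqrt_iter P n' (sqrt_iter P n' x))
  else fun=> 0.

Fixpoint sqrt_bound (n : nat) : R :=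
  if n is n'.+1 then 2^-1 * (1 + sqrt_bound n' ^+ 2) else 0.

Lemma sqrt_bound_ge0 n : 0 <= sqrt_bound n.
Proof.
by case: n => //= n; rewrite mulr_ge0// addr_ge0// sqr_ge0.
Qed.

Lemma sqrt_bound_le1 n : sqrt_bound n <= 1.
Proof.
elim: n => //= n IH; have := sqrt_bound_ge0 n; nra.
Qed.

Lemma sqrt_bound_incr n : sqrt_bound n <= sqrt_bound n.+1.
Proof.
elim: n => [|n IH]; first by rewrite /= expr0n addr0 mulr1 invr_ge0.
have := sqrt_bound_ge0 n; rewrite /= in IH *; nra.
Qed.

Section square_root.
Context (P : X -> X).
Context (P_lin : linear P) (P_le1 : forall x, `|P x| <= `|x|).
Context (P_sym : forall x y, ip (P x) y = ip x (P y)).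
Let Y := sqrt_iter P.
Let b := sqrt_bound.

Let Y0 x : Y 0 x = 0. Proof. by []. Qed.

Let YS n x : Y n.+1 x = 2^-1 *: (P x + Y n (Y n x)). Proof. by []. Qed.

Let bS n : b n.+1 = 2^-1 * (1 + b n ^+ 2). Proof. by []. Qed.

Let Y_lin n : linear (Y n).
Proof.
elim: n => [|n IH] a u v; first by rewrite !Y0 scaler0 addr0.
rewrite !YS P_lin !IH addrACA -scalerDr [LHS]scalerDr.
by rewrite !scalerA mulrC.
Qed.

Let Y_sym n x y : ip (Y n x) y = ip x (Y n y).
Proof.
elim: n x y => [|n IH] x y; first by rewrite ip0l ip0r.
by rewrite !YS ipZl ipZr ipDl ipDr P_sym !IH.
Qed.

Let Y_norm n x : `|Y n x| <= b n * `|x|.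
Proof.
elim: n x => [|n IH] x; first by rewrite normr0 mul0r.
rewrite YS bS normrZ ger0_norm// -mulrA ler_wpM2l//.
rewrite (le_trans (ler_normD _ _))// mulrDl mul1r lerD//.
by rewrite (le_trans (IH _))// expr2 -mulrA ler_wpM2l// sqrt_bound_ge0.
Qed.

Let Y_commP n x : Y n (P x) = P (Y n x).
Proof.
elim: n x => [|n IH] x; first by rewrite !Y0 lin0.
by rewrite !YS (linZ _ P_lin) (linD _ P_lin) !IH.
Qed.

Let Y_comm m n x : Y n (Y m x) = Y m (Y n x).
Proof.
elim: n x => [|n IH] x; first by rewrite !Y0 lin0.
by rewrite !YS (linZ _ (Y_lin m)) (linD _ (Y_lin m)) !IH Y_commP.
Qed.

(** The iterates commute, so the difference of the squares of two consecutive ones factors as sum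
    times difference; the scalars [b] obey the same factorization, and the estimate propagates
    factor by factor. *)
Let Y_step n x : `|Y n.+1 x - Y n x| <= (b n.+1 - b n) * `|x|.
Proof.
elim: n x => [|n IH] x.
  by rewrite !Y0 subr0 [b 0]/= subr0; exact: Y_norm.
have -> : Y n.+2 x - Y n.+1 x =
    2^-1 *: (Y n.+1 (Y n.+1 x - Y n x) + Y n (Y n.+1 x - Y n x)).
  rewrite !(linB _ (Y_lin _)) (Y_comm n.+1 n) addrA subrK.
  by rewrite (YS n.+1) [in X in _ - X](YS n) -scalerBr opprD addrACA subrr add0r.
have -> : b n.+2 - b n.+1 = 2^-1 * ((b n.+1 + b n) * (b n.+1 - b n)).
  by rewrite (bS n.+1) [in X in _ - X](bS n); ring.
rewrite normrZ ger0_norm// -mulrA ler_wpM2l//.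
rewrite (le_trans (ler_normD _ _))// -mulrA mulrDl lerD//.
  by rewrite (le_trans (Y_norm _ _))// ler_wpM2l// sqrt_bound_ge0.
by rewrite (le_trans (Y_norm _ _))// ler_wpM2l// sqrt_bound_ge0.
Qed.

Let Y_dist {n m} x : (n <= m)%N -> `|Y m x - Y n x| <= (b m - b n) * `|x|.
Proof.
move=> /subnK <-; elim: (m - n)%N => [|k IH].
  by rewrite add0n !subrr normr0 mul0r.
rewrite addSn -(subrK (Y (k + n)%N x) (Y _.+1 x)) -addrA.
rewrite (le_trans (ler_normD _ _))//.
rewrite -(subrK (b (k + n)%N) (b _.+1)) -[X in X * _]addrA mulrDl lerD ?Y_step//.
Qed.

Lemma contraction_sqrt : exists S, [/\ linear S,
  forall x y, ip (S x) y = ip x (S y), forall x, 0 <= ip (S x) x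
  & forall x, S (S x) = x - P x].
Proof.
have b_cvg : b n @[n --> \oo] --> sup (range b).
  apply: nondecreasing_cvgn; first exact/nondecreasing_seqP/sqrt_bound_incr.
  by exists 1 => _ [n _ <-]; exact: sqrt_bound_le1.
set l := sup _ in b_cvg.
have bl n : b n <= l.
  apply: ub_le_sup; last by exists n.
  by exists 1 => _ [k _ <-]; exact: sqrt_bound_le1.
have d0 x : (l - b n) * `|x| @[n --> \oo] --> 0.
  rewrite -(mul0r `|x|) -(subrr l).
  by apply: cvgM; [apply: cvgB => //; exact: cvg_cst|exact: cvg_cst].
have /choice[Z YZ] x : exists z : X, Y n x @[n --> \oo] --> z.
  apply: (@cauchy_bound_cvg _ (fun n => (l - b n) * `|x|)) => // n m nm.
  by rewrite (le_trans (Y_dist _ nm))// ler_wpM2r// lerD2r.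
have Z_norm x : `|Z x| <= `|x|.
  apply: (norm_le_of_cvg (YZ x)) => n.
  by rewrite (le_trans (Y_norm _ _))// ler_piMl// sqrt_bound_le1.
have Z_sym x y : ip (Z x) y = ip x (Z y).
  have h1 : ip (Y n x) y @[n --> \oo] --> ip (Z x) y by exact: cvg_ipl.
  have h2 : ip (Y n y) x @[n --> \oo] --> ip (Z y) x by exact: cvg_ipl.
  have E : (fun n => ip (Y n x) y) = (fun n => ip (Y n y) x).
    by apply/funext => n; rewrite Y_sym ipC.
  by rewrite (ipC x); rewrite E in h1; exact: (cvg_unique _ h1 h2).
have Z_lin : linear Z.
  move=> a u v.
  have h : a *: Y n u + Y n v @[n --> \oo] --> a *: Z u + Z v.
    by apply: cvgD => //; exact: cvgZr.
  have E : (fun n => a *: Y n u + Y n v) = (fun n => Y n (a *: u + v)).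
    by apply/funext => n; rewrite Y_lin.
  by rewrite E in h; exact: (cvg_unique _ (YZ _) h).
have Z_fix x : Z x = 2^-1 *: (P x + Z (Z x)).
  have h1 : Y n.+1 x @[n --> \oo] --> Z x.
    by have := YZ x; rewrite -(cvg_shiftS (fun n => Y n x)).
  have dZ : `|Y n x - Z x| @[n --> \oo] --> 0.
    rewrite -(@normr0 _ X) -(subrr (Z x)); apply: cvg_norm.
    by apply: cvgB => //; exact: cvg_cst.
  (* Strong limits do not compose by themselves: [Y n (Y n x)] is split at [Y n (Z x)], and the
     uniform bound [|Y n| <= 1] removes the remainder. *)
  have h2 : Y n (Y n x - Z x) @[n --> \oo] --> 0.
    apply: (cvg_of_dist_le dZ) => n.
    by rewrite subr0 (le_trans (Y_norm _ _))// ler_piMl// sqrt_bound_le1.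
  have h3 : 2^-1 *: (P x + (Y n (Y n x - Z x) + Y n (Z x))) @[n --> \oo] -->
      2^-1 *: (P x + (0 + Z (Z x))).
    by apply: cvgZr; apply: cvgD; [exact: cvg_cst|exact: cvgD].
  rewrite add0r in h3.
  have E : (fun n => 2^-1 *: (P x + (Y n (Y n x - Z x) + Y n (Z x)))) =
      (fun n => Y n.+1 x).
    by apply/funext => n; rewrite -(linD _ (Y_lin n)) subrK.
  by rewrite E in h3; exact: (cvg_unique _ h1 h3).
exists (fun x => x - Z x); split.
- by move=> a u v; rewrite Z_lin scalerBr opprD addrACA.
- by move=> x y; rewrite ipBl ipBr Z_sym.
- move=> x; rewrite ipBl subr_ge0 ip_norm.
  rewrite (le_trans (ip_le_norm _ _))// expr2 ler_wpM2r//.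
- move=> x; have ZZ : Z (Z x) = Z x + Z x - P x.
    have /(congr1 (fun z => 2 *: z)) := Z_fix x.
    rewrite scalerA divff// scale1r scaler_nat mulr2n => ->.
    by rewrite addrAC subrr add0r.
  by rewrite (linB _ Z_lin) ZZ opprB [_ - P x - _]addrAC addrK addrA subrK.
Qed.

End square_root.

(** With [c] a bound of [A], the operator [P = 1 - A / c] is a contraction, so [1 - P = A / c] has a
    root, which is then multiplied by the square root of [c]. *)
Lemma sqrt_opP A : nonneg_selfadjoint ip A ->
  nonneg_selfadjoint ip (sqrt_op ip A) /\
  forall x, sqrt_op ip A (sqrt_op ip A x) = A x.
Proof.
move=> [[Al Ac] As An]; have [c c0 AC] := linear_continuous_bound A Al Ac.
pose P x := x - c^-1 *: A x.
have Pl : linear P.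
  move=> a u v; rewrite /P (linD _ Al) (linZ _ Al) !scalerDr opprD addrACA.
  by rewrite scalerN !scalerA mulrC.
have Ps x y : ip (P x) y = ip x (P y) by rewrite ipBl ipBr ipZl ipZr As.
have Pn x : 0 <= ip (P x) x.
  rewrite ipBl ipZl ip_norm subr_ge0 ler_pdivrMl// (le_trans (ip_le_norm _ _))//.
  by rewrite expr2 mulrA ler_wpM2r.
have Pq x : ip (P x) x <= `|x| ^+ 2.
  by rewrite ipBl ipZl ip_norm gerBl mulr_ge0// invr_ge0 ltW.
(* Cauchy-Schwarz for the form of [P] gives [|P x|^4 <= ip (P x) x * ip (P (P x)) (P x)], which is
   at most [|x|^2 |P x|^2]. *)
have P1 x : `|P x| <= `|x|.
  have [->|Px0] := eqVneq (P x) 0; first by rewrite normr0.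
  rewrite -(@ler_pXn2r _ 2)// ?nnegrE//.
  have := nonneg_cauchy_schwarz P Pl Ps Pn x (P x); rewrite ip_norm.
  have := Pq x; have := Pq (P x); have := Pn x; have := Pn (P x).
  have : 0 < `|P x| ^+ 2 by rewrite exprn_gt0// normr_gt0.
  set p := `|P x| ^+ 2; set q := ip (P x) x; set r := ip (P (P x)) _ => *.
  by have : p * p <= p * `|x| ^+ 2 by [nra]; rewrite ler_pM2l.
have [S [Sl Ss Sn SS]] := contraction_sqrt P Pl P1 Ps.
have c2 : Num.sqrt c * Num.sqrt c = c by rewrite -expr2 sqr_sqrtr// ltW.
suff /getPex[] : exists T, nonneg_selfadjoint ip T /\ T \o T = A.
  by move=> ? /funeqP.
exists (fun x => Num.sqrt c *: S x); split.
  have Tl : linear (fun x => Num.sqrt c *: S x).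
    by move=> a u v; rewrite Sl scalerDr !scalerA mulrC.
  have Ts x y : ip (Num.sqrt c *: S x) y = ip x (Num.sqrt c *: S y).
    by rewrite ipZl ipZr Ss.
  split => //; first exact: symmetric_bounded.
  by move=> x; rewrite ipZl mulr_ge0// sqrtr_ge0.
apply/funext => x /=; rewrite (linZ _ Sl) SS scalerA c2 /P opprB addrCA subrr.
by rewrite addr0 scalerA divff ?lt0r_neq0// scale1r.
Qed.

(** * Orthonormal bases *)

Definition orthonormal_set (E : set X) :=
  forall e e', E e -> E e' -> ip e e' = (e == e')%:R.

Lemma orthonormal_basis_exists : exists E, orthonormal_basis ip E.
Proof.
have [F FP totF|E [Eon Emax]] := @Zorn_bigcup X orthonormal_set.
  move=> e e' [A FA Ae] [A' FA' Ae'].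
  have [AA'|A'A] := totF _ _ FA FA'.
    by apply: (FP _ FA') => //; exact: AA'.
  by apply: (FP _ FA) => //; exact: A'A.
exists E; split => // x xE; apply/eqP/negPn/negP => x0.
pose e := `|x|^-1 *: x.
have ee : ip e e = 1.
  rewrite ip_norm normrZ normfV normr_id mulVf ?normr_eq0// expr1n//.
have eE e' : E e' -> ip e e' = 0 by move=> Ee'; rewrite ipZl xE// mulr0.
have En : ~ E e by move=> /eE; rewrite ee => /eqP; rewrite oner_eq0.
apply: (Emax (E `|` [set e])).
  split; first by left.
  by move=> /(_ e) /(_ (or_intror erefl)).
move=> u v [Eu|->] [Ev|->].
- exact: Eon.
- rewrite ipC eE//; case: eqP => // ue; exfalso; apply: En; rewrite -ue//.
- rewrite eE//; case: eqP => // ue; exfalso; apply: En; rewrite ue//.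
- by rewrite ee eqxx.
Qed.

(** Distinct orthonormal vectors are at distance sqrt 2, more than 1, so points of the dense set
    chosen within 1/2 of them are distinct. *)
Lemma orthonormal_set_countable E : separable_space X -> orthonormal_set E ->
  countable E.
Proof.
move=> [D /countable_injP[f finj] Dd] Eon.
have /choice[g gP] x : exists d, D d /\ `|x - d| < 2^-1.
  have [|y [xy Dy]] := Dd (ball x 2^-1) _ (ball_open x 2^-1).
    by exists x; apply: ballxx.
  by exists y; split => //; rewrite -ball_normE in xy.
apply/countable_injP; exists (f \o g) => x y /set_mem Ex /set_mem Ey /= fxy.
have gxy : g x = g y.
  by apply: finj => //; apply/mem_set; [exact: (gP x).1|exact: (gP y).1].
apply/eqP/negPn/negP => xy.
have : `|x - y| < 1.
  rewrite -(subrK (g x) x) -addrA (le_lt_trans (ler_normD _ _))//.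
  rewrite (splitr 1) mul1r ltrD//; first exact: (gP x).2.
  by rewrite gxy distrC; exact: (gP y).2.
rewrite -(@ltr_pXn2r _ 2)// ?nnegrE// normB_sqr -!ip_norm !Eon// !eqxx.
by rewrite (negbTE xy) mulr0 subr0 expr1n/=; lra.
Qed.

(* An orthonormal basis enumerated by [nat]; when it is finite the enumeration
   is padded with zeros. *)
Definition basis_seq (e : nat -> X) :=
  [/\ forall i, e i != 0 -> ip (e i) (e i) = 1,
      forall i j, i != j -> ip (e i) (e j) = 0
    & forall x, (forall i, ip x (e i) = 0) -> x = 0].

(** The sequence enumerates the very basis chosen inside [op_trace], so its partial sums are finite
    sub-sums of that trace. *)
Lemma basis_seq_trace : separable_space X ->
  exists2 e, basis_seq e & forall A n, (forall x, 0 <= ip (A x) x) ->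
    ((\sum_(i < n) ip (A (e i)) (e i))%:E <= op_trace ip A)%E.
Proof.
move=> Xsep; have [Eon Ec] := getPex orthonormal_basis_exists.
rewrite -[get _]/(get (orthonormal_basis ip)) in Eon Ec.
set E := get (orthonormal_basis ip) in Eon Ec.
have /countable_injP[f finj] := orthonormal_set_countable E Xsep Eon.
have /choice[e eP] n : exists x, (E x /\ f x = n) \/
    (x = 0 /\ ~ exists y, E y /\ f y = n).
  have [[y yP]|h] := pselect (exists y, E y /\ f y = n).
    by exists y; left.
  by exists 0; right.
have e0 i : e i != 0 -> E (e i) /\ f (e i) = i.
  by move=> ei; have [//|[ei0]] := eP i; rewrite ei0 eqxx in ei.
exists e; first split.
- by move=> i /e0[Ei _]; rewrite Eon// eqxx.
- move=> i j ij; have [->|/e0[Ei fi]] := eqVneq (e i) 0; first by rewrite ip0l.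
  have [->|/e0[Ej fj]] := eqVneq (e j) 0; first by rewrite ip0r.
  rewrite Eon//; case: eqP => // eij; move: ij.
  by rewrite -fi -fj eij eqxx.
- move=> x xe; apply: Ec => y Ey; have [[Ei fi]|[_ []]] := eP (f y).
    have ey : e (f y) = y by apply: finj => //; apply/mem_set.
    by have := xe (f y); rewrite ey.
  by exists y.
- move=> A n An; apply: esum_ge.
  (* The padding zeros are dropped: they lie outside [E] and would be repeated, and their terms in
     the sum vanish. *)
  pose r := [seq e i | i <- [seq i <- iota 0 n | e i != 0]].
  exists [set` r].
    split; first by apply/finite_seqP; exists r.
    by move=> _ /= /mapP[i + ->]; rewrite mem_filter => /andP[/e0[]].
  rewrite -fsbig_seq; last first.
    rewrite map_inj_in_uniq ?filter_uniq ?iota_uniq// => i j.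
    rewrite !mem_filter => /andP[/e0[_ fi] _] /andP[/e0[_ fj] _] eij.
    by rewrite -fi -fj eij.
  rewrite -(big_mkord xpredT (fun i => ip (A (e i)) (e i))) /index_iota subn0.
  rewrite big_map big_filter sumEFin lee_fin [leRHS]big_mkcond/=.
  apply: ler_sum => i _.
  by case: ifPn => // /negPn/eqP ->; rewrite ip0r.
Qed.

(** * Expansion in an orthonormal basis *)

Section expansion.
Context (e : nat -> X) (eP : basis_seq e).

Definition partial_expansion n v := \sum_(i < n) ip v (e i) *: e i.

Lemma ip_partial_expansion n v w :
  ip (partial_expansion n v) w = \sum_(i < n) ip v (e i) * ip w (e i).
Proof.
by rewrite ip_suml; apply: eq_bigr => i _; rewrite ipZl (ipC w).
Qed.

Let ip_basis (v : X) i : ip v (e i) * ip (e i) (e i) = ip v (e i).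
Proof.
have [->|ei] := eqVneq (e i) 0; first by rewrite !ip0r mulr0.
by case: eP => h _ _; rewrite (h _ ei) mulr1.
Qed.

Let ip_partial_expansion_basis n v (i : nat) : (i < n)%N ->
  ip (partial_expansion n v) (e i) = ip v (e i).
Proof.
move=> ilt; rewrite ip_partial_expansion (bigD1 (Ordinal ilt))//= ip_basis.
rewrite big1 ?addr0// => j ji; case: eP => _ h _.
by rewrite (h i j) ?mulr0// eq_sym.
Qed.

Let norm_partial_expansion_sub n m v : (n <= m)%N ->
  `|partial_expansion m v - partial_expansion n v| ^+ 2 =
  \sum_(i < m) ip v (e i) ^+ 2 - \sum_(i < n) ip v (e i) ^+ 2.
Proof.
have ipE k l : (k <= l)%N -> ip (partial_expansion k v) (partial_expansion l v) =
    \sum_(i < k) ip v (e i) ^+ 2.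
  move=> kl; rewrite ip_partial_expansion; apply: eq_bigr => i _.
  by rewrite ip_partial_expansion_basis ?expr2// (leq_trans (ltn_ord i)).
move=> nm; rewrite normB_sqr -!ip_norm.
rewrite (ipC (partial_expansion m v) (partial_expansion n v)) !ipE//.
by ring.
Qed.

Lemma bessel n v : \sum_(i < n) ip v (e i) ^+ 2 <= `|v| ^+ 2.
Proof.
have := sqr_ge0 `|v - partial_expansion n v|.
rewrite normB_sqr -(ip_norm (partial_expansion n v)) (ipC v).
rewrite !ip_partial_expansion.
rewrite (eq_bigr (fun i : 'I_n => ip v (e i) ^+ 2)) ?expr2//.
rewrite [X in _ + X](eq_bigr (fun i : 'I_n => ip v (e i) ^+ 2)); last first.
  by move=> i _; rewrite ip_partial_expansion_basis ?expr2.
lra.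
Qed.

(** Bessel's inequality makes the partial sums Cauchy; their limit has the same coefficients as [v],
    hence equals [v] by completeness of the basis. *)
Lemma cvg_partial_expansion v : partial_expansion n v @[n --> \oo] --> v.
Proof.
pose sg n := \sum_(i < n) ip v (e i) ^+ 2.
have sg_ub : has_ubound (range sg).
  by exists (`|v| ^+ 2) => _ [n _ <-]; exact: bessel.
have sg_cvg : sg @ \oo --> sup (range sg).
  apply: nondecreasing_cvgn => //; apply/nondecreasing_seqP => n.
  by rewrite /sg big_ord_recr/= lerDl sqr_ge0.
have sg_le n : sg n <= sup (range sg) by apply: ub_le_sup => //; exists n.
have d0 : Num.sqrt (sup (range sg) - sg n) @[n --> \oo] --> 0.
  have h : sup (range sg) - sg n @[n --> \oo] --> sup (range sg) - sup (range sg).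
    by apply: cvgB => //; exact: cvg_cst.
  rewrite subrr in h; rewrite -sqrtr0.
  exact: (cvg_comp _ _ h (@sqrt_continuous R 0)).
have [p vp] : exists p : X, partial_expansion n v @[n --> \oo] --> p.
  apply: (cauchy_bound_cvg _ _ d0) => n m nm.
  rewrite -(@ler_pXn2r _ 2)// ?nnegrE ?sqrtr_ge0// sqr_sqrtr ?subr_ge0//.
  by rewrite norm_partial_expansion_sub//; exact: lerB (sg_le m) (lexx _).
suff vE : v = p by rewrite [X in _ --> X]vE.
apply/eqP; rewrite -subr_eq0; apply/eqP; case: eP => _ _; apply => i.
apply/eqP; rewrite ipBl subr_eq0; apply/eqP/esym.
have h : ip (partial_expansion n v) (e i) @[n --> \oo] --> ip p (e i).
  exact: cvg_ipl.
have h' : ip (partial_expansion n v) (e i) @[n --> \oo] --> ip v (e i).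
  apply: cvg_near_cst; exists i.+1 => // n /= ni.
  exact: ip_partial_expansion_basis.
exact: (cvg_unique _ h h').
Qed.

Lemma parseval v w :
  \sum_(i < n) ip v (e i) * ip w (e i) @[n --> \oo] --> ip v w.
Proof.
have h : ip (partial_expansion n v) w @[n --> \oo] --> ip v w.
  by apply: cvg_ipl; exact: cvg_partial_expansion.
by apply: cvg_trans h; apply: near_eq_cvg; apply: nearW => n; rewrite ip_partial_expansion.
Qed.

(** * Bochner integrals *)

Local Notation mu := (@lebesgue_measure R).
Local Notation TR := (measurableTypeR R).

Lemma separable_dense_seq : separable_space X ->
  exists2 d : nat -> X, d 0 = 0 & forall x (eps : R), 0 < eps ->
    exists k, `|x - d k| < eps.
Proof.
move=> [D /countable_injP[f finj] Dd].
have /choice[d dP] n : exists x, (D x /\ f x = n) \/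
    (x = 0 /\ ~ exists y, D y /\ f y = n).
  have [[y yP]|h] := pselect (exists y, D y /\ f y = n).
    by exists y; left.
  by exists 0; right.
exists (fun n => if n is k.+1 then d k else 0) => // x eps eps0.
have [|y [xy Dy]] := Dd (ball x eps) _ (ball_open x eps).
  by exists x; apply: ballxx.
exists (f y).+1; have [[Di fi]|[_ []]] := dP (f y); last by exists y.
have -> : d (f y) = y by apply: finj => //; apply/mem_set.
by rewrite -ball_normE in xy.
Qed.

Fixpoint nearest (d : nat -> X) n z : X :=
  if n is n'.+1 then
    if `|z - d n| < `|z - nearest d n' z| then d n else nearest d n' z
  else d 0.

Lemma nearest_le d n k z : (k <= n)%N -> `|z - nearest d n z| <= `|z - d k|.
Proof.
elim: n => [|n IH]; first by rewrite leqn0 => /eqP ->.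
rewrite leq_eqVlt => /orP[/eqP ->|/IH kn] /=; case: ltP => //.
by move=> /ltW h; exact: le_trans kn.
Qed.

(** Testing against fixed vectors lets an adjoint be moved to the other side of the inner product,
    so that measurability of [B(r)] and [U(t,r)] yields that of their adjoints. Parseval recovers
    the measurability of norms. *)
Definition weakly_measurable (D : set TR) (f : R -> X) :=
  forall y, measurable_fun D (fun r => ip (f r) y).

Section bochner.
Context {D : set TR} (mD : measurable D).
Implicit Types (f g s : R -> X).

Lemma weakly_measurable_ip {f g} : weakly_measurable D f -> weakly_measurable D g ->
  measurable_fun D (fun r => ip (f r) (g r)).
Proof.
move=> mf mg; apply: (@measurable_fun_cvg _ _ _ _
  (fun n r => \sum_(i < n) ip (f r) (e i) * ip (g r) (e i))).
  move=> n; apply: measurable_sum => i.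
  by apply: measurable_funM; [exact: mf|exact: mg].
by move=> r _; exact: parseval.
Qed.

Lemma weakly_measurable_norm {f} : weakly_measurable D f ->
  measurable_fun D (fun r => `|f r|).
Proof.
move=> mf; have -> : (fun r => `|f r|) = Num.sqrt \o (fun r => ip (f r) (f r)).
  by apply/funext => r /=; rewrite ip_norm sqrtr_sqr normr_id.
exact: (measurableT_comp (continuous_measurable_fun (@sqrt_continuous R))
  (weakly_measurable_ip mf mf)).
Qed.

Lemma weakly_measurableB {f g} : weakly_measurable D f -> weakly_measurable D g ->
  weakly_measurable D (fun r => f r - g r).
Proof.
move=> mf mg y; under eq_fun do rewrite ipBl.
by apply: measurable_funB; [exact: mf|exact: mg].
Qed.

(** * Integrals of simple functions *)

Section simple.
Context (g : R -> X) (rs : seq X) (rs_uniq : uniq rs).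
Context (g_rs : forall r, g r \in rs).
Context (mg : forall v, measurable (D `&` g @^-1` [set v])).

Let level v : set TR := D `&` g @^-1` [set v].

Lemma simple_expand (h : X -> R) r : D r ->
  h (g r) = \sum_(v <- rs) \1_(level v) r * h v.
Proof.
move=> Dr; rewrite (bigD1_seq (g r))//= big1 ?addr0.
  by rewrite indicE mem_set// mul1r.
move=> v vg; rewrite indicE memNset ?mul0r// => -[_ /= gv].
by rewrite gv eqxx in vg.
Qed.

Lemma simple_measurable (h : X -> R) : measurable_fun D (h \o g).
Proof.
apply: (eq_measurable_fun (fun r => \sum_(v <- rs) \1_(level v) r * h v)).
  by move=> r /set_mem Dr; rewrite -simple_expand.
apply: measurable_sum => v; apply: measurable_funM => //.
exact: (measurable_indic (mg v)).
Qed.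

Lemma simple_integralP (h : X -> R) : h 0 = 0 ->
  (forall v, v != 0 -> (mu (level v) < +oo)%E) ->
  mu.-integrable D (EFin \o (h \o g)) /\
  \int[mu]_(r in D) h (g r) = \sum_(v <- rs) fine (mu (level v)) * h v.
Proof.
move=> h0 fin.
have int1 v : mu.-integrable D (EFin \o (fun r => \1_(level v) r * h v)) /\
    \int[mu]_(r in D) (\1_(level v) r * h v) = fine (mu (level v)) * h v.
  have [->|v0] := eqVneq v 0.
    rewrite h0 mulr0; under eq_Rintegral do rewrite mulr0.
    split; last by rewrite Rintegral_cst// mul0r.
    rewrite (_ : EFin \o _ = cst 0%E); first exact: integrable0.
    by apply/funext => r /=; rewrite mulr0.
  have int_ind : mu.-integrable D (EFin \o (\1_(level v) : TR -> R)).
    apply/integrableP; split.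
      by apply/measurable_EFinP; exact: (measurable_indic (mg v)).
    rewrite (eq_integral (fun r => (\1_(level v) r)%:E)); last first.
      by move=> r _ /=; rewrite ger0_norm.
    by rewrite (integral_indic _ mD (mg v)) setIAC setIid; exact: fin.
  split.
    have := integrableZl mD (h v) int_ind.
    by under eq_fun do rewrite /= muleC.
  rewrite RintegralZr//; congr (fine _ * _).
  by rewrite (integral_indic _ mD (mg v)) setIAC setIid.
suff [h1 h2] : mu.-integrable D
    (EFin \o (fun r => \sum_(v <- rs) \1_(level v) r * h v)) /\
    \int[mu]_(r in D) (\sum_(v <- rs) \1_(level v) r * h v) =
    \sum_(v <- rs) fine (mu (level v)) * h v.
  split.
    apply: (eq_integrable mD _ _ _ h1) => r /set_mem Dr.
    by rewrite /= -simple_expand.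
  rewrite -h2; apply: eq_Rintegral => r /set_mem Dr; exact: simple_expand.
elim: (rs) => [|v s [IH1 IH2]].
  rewrite big_nil; under eq_Rintegral do rewrite big_nil.
  split; last by rewrite Rintegral_cst// mul0r.
  rewrite (_ : EFin \o _ = cst 0%E); first exact: integrable0.
  by apply/funext => r /=; rewrite big_nil.
have [i1 i2] := int1 v.
split.
  have := integrableD mD i1 IH1.
  by under eq_fun do rewrite /= -EFinD
    -(big_cons 0 +%R v s xpredT (fun v => \1_(level v) _ * h v)).
under eq_Rintegral do rewrite big_cons.
by rewrite RintegralD// i2 IH2 big_cons.
Qed.

End simple.

Lemma integrable_simple_seq s : integrable_simple D s ->
  exists rs : seq X, [/\ uniq rs, forall r, s r \in rs, range s = [set` rs],
    forall v, measurable (D `&` s @^-1` [set v])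
    & forall v, v != 0 -> (mu (D `&` s @^-1` [set v]) < +oo)%E].
Proof.
move=> [/finite_seqP[rs rsE] sP]; exists (undup rs); split.
- exact: undup_uniq.
- move=> r; rewrite mem_undup; have : range s (s r) by exists r.
  by rewrite rsE.
- by rewrite rsE; apply/seteqP; split => v /=; rewrite mem_undup.
- by move=> v; apply: measurableI => //; exact: (sP v).1.
- by move=> v v0; exact: (sP v).2.
Qed.

Lemma integrable_simple_weakly_measurable s : integrable_simple D s ->
  weakly_measurable D s.
Proof.
move=> /integrable_simple_seq[rs [rsu srs _ ms _]] y.
exact: (@simple_measurable _ rs rsu srs ms (ip ^~ y)).
Qed.

Lemma ip_simple_integral s y : integrable_simple D s ->
  mu.-integrable D (EFin \o (fun r => ip (s r) y)) /\
  ip (simple_integral D s) y = \int[mu]_(r in D) ip (s r) y.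
Proof.
move=> /integrable_simple_seq[rs [rsu srs rsE ms fs]].
have [|//|h1 h2] := @simple_integralP _ rs rsu srs ms (ip ^~ y).
  exact: ip0l.
split=> //; rewrite h2 /simple_integral rsE -fsbig_seq// ip_suml.
by apply: eq_bigr => v _; rewrite ipZl.
Qed.

Lemma integrable_simple_norm s : integrable_simple D s ->
  mu.-integrable D (EFin \o (fun r => `|s r|)).
Proof.
move=> /integrable_simple_seq[rs [rsu srs rsE ms fs]].
by have [|//|//] := @simple_integralP _ rs rsu srs ms (fun v => `|v|); exact: normr0.
Qed.

(** * Existence and weak characterization of the Bochner integral *)

Section integrable_function.
Context {f : R -> X} (mf : weakly_measurable D f).
Context (intf : mu.-integrable D (EFin \o (fun r => `|f r|))).

Lemma integrable_ip y : mu.-integrable D (EFin \o (fun r => ip (f r) y)).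
Proof.
apply: (le_integrable mD _ _ (integrableZl mD `|y| intf)).
  by apply/measurable_EFinP; exact: mf.
move=> r _; rewrite /= lee_fin.
by rewrite [leRHS]ger0_norm ?mulr_ge0// mulrC cauchy_schwarz.
Qed.

(** This estimate is used twice: with [w] the error itself it gives norm convergence of the simple
    integrals, and with [w] fixed it identifies the limit. *)
Lemma simple_integral_dist {s} w : integrable_simple D s ->
  `|ip (simple_integral D s) w - \int[mu]_(r in D) ip (f r) w| <=
  fine (\int[mu]_(r in D) (`|f r - s r|)%:E)%E * `|w|.
Proof.
move=> hs; have [h1 ->] := ip_simple_integral s w hs.
have ms := integrable_simple_weakly_measurable s hs.
have intd : mu.-integrable D (EFin \o (fun r => `|f r - s r|)).
  apply: (le_integrable mD _ _ (integrableD mD intf (integrable_simple_norm s hs))).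
    apply/measurable_EFinP; apply: weakly_measurable_norm.
    exact: weakly_measurableB.
  move=> r _; rewrite /= lee_fin normr_id.
  by rewrite [leRHS]ger0_norm ?addr_ge0//; exact: ler_normB.
have h2 := integrable_ip w.
rewrite -RintegralB//.
have intB : mu.-integrable D (EFin \o (fun r => ip (s r) w - ip (f r) w)).
  by have := integrableB mD h1 h2.
rewrite (le_trans (le_normr_Rintegral mD intB))//.
rewrite -[X in X * _]/(\int[mu]_(r in D) `|f r - s r|) -RintegralZr//.
apply: le_Rintegral => //; first exact: (integrable_norm intB).
  have := integrableZl mD `|w| intd.
  by under eq_fun do rewrite /= muleC.
by move=> r _; rewrite -ipBl distrC cauchy_schwarz.
Qed.

Lemma nearest_simple d n :
  finite_set (range (nearest d n \o f)) /\
  forall v, measurable (D `&` (nearest d n \o f) @^-1` [set v]).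
Proof.
elim: n => [|n [/finite_seqP[rs0 rs0E] IH]].
  split.
    apply: (@sub_finite_set _ _ [set d 0]); last exact: finite_set1.
    by move=> _ [r _ <-].
  move=> v; have [->|vd] := eqVneq v (d 0).
    by rewrite (_ : _ @^-1` _ = setT) ?setIT//; apply/seteqP; split.
  rewrite (_ : _ @^-1` _ = set0) ?setI0//; apply/seteqP; split => // r /= dv.
  by rewrite dv eqxx in vd.
pose rs := undup rs0.
have rsP r : nearest d n (f r) \in rs.
  rewrite mem_undup; have : range (nearest d n \o f) (nearest d n (f r)) by exists r.
  by rewrite rs0E.
have mn : weakly_measurable D (nearest d n \o f).
  move=> y; exact: (@simple_measurable _ rs (undup_uniq _) rsP IH (ip ^~ y)).
split.
  apply: (@sub_finite_set _ _ ([set` rs0] `|` [set d n.+1])).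
    move=> _ [r _ <-] /=; case: ifPn => _; first by right.
    by left; have := rsP r; rewrite mem_undup.
  by rewrite finite_setU; split; [apply/finite_seqP; exists rs0|exact: finite_set1].
(* [A] is where the new term is strictly nearer than the previous choice. It compares two norms, and
   the previous choice is weakly measurable because it is simple. *)
pose A := D `&` [set r | `|f r - d n.+1| < `|f r - nearest d n (f r)|].
have mA : measurable A.
  have mc : weakly_measurable D (fun=> d n.+1) by move=> y.
  have := measurable_fun_ltr (weakly_measurable_norm (weakly_measurableB mf mc))
    (weakly_measurable_norm (weakly_measurableB mf mn)).
  by move=> /(_ mD [set true]); apply.
move=> v; have [->|vd] := eqVneq v (d n.+1).
  rewrite (_ : _ `&` _ =
      A `|` (D `&` (nearest d n \o f) @^-1` [set d n.+1])).
    exact: measurableU.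
  apply/seteqP; split => r /=.
    by move=> [Dr]; case: ifPn => [h _|_ ->]; [left|right].
  by move=> [[Dr h]|[Dr h]]; split => //; case: ifPn => // /negP.
rewrite (_ : _ `&` _ = (D `&` (nearest d n \o f) @^-1` [set v]) `\` A).
  exact: measurableD.
apply/seteqP; split => r /=.
  move=> [Dr]; case: ifPn => [_ /esym/eqP|h <-]; first by rewrite (negbTE vd).
  by split => // -[_ /=]; apply/negP.
by move=> [[Dr h] nA]; split => //; case: ifPn => // h'; exfalso; apply: nA.
Qed.

(* [s n r] is a point nearest to [f r] among the first [n + 1] terms of a dense
   sequence starting at [0], whence [|f r - s n r| <= |f r|]. *)
Lemma is_bochner_integral_exists : separable_space X ->
  exists v, is_bochner_integral D f v.
Proof.
move=> /separable_dense_seq[d d0 dd].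
(* Truncation to a bounded window gives the nonzero level sets finite measure. *)
pose C n : set TR := D `&` `[- n%:R, n%:R].
have mC n : measurable (C n) by apply: measurableI => //; exact: measurable_itv.
pose s n r := if r \in C n then nearest d n (f r) else 0.
have s_simple n : integrable_simple D (s n).
  have [fin meas] := nearest_simple d n; split.
    apply: (@sub_finite_set _ _ (range (nearest d n \o f) `|` [set 0])).
      move=> _ [r _ <-]; rewrite /s; case: ifPn => _; last by right.
      by left; exists r.
    by rewrite finite_setU; split => //; exact: finite_set1.
  have mCv v : measurable (C n `&` (nearest d n \o f) @^-1` [set v]).
    rewrite (_ : _ `&` _ = C n `&` (D `&` (nearest d n \o f) @^-1` [set v])).
      exact: measurableI.
    by apply/seteqP; split => r [[? ?]]; [|case].
  have sv v : v != 0 ->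
      s n @^-1` [set v] = C n `&` (nearest d n \o f) @^-1` [set v].
    move=> v0; apply/seteqP; split => r /=; rewrite /s.
      case: ifPn => [/set_mem Cr <-//|_ /esym/eqP].
      by rewrite (negbTE v0).
    by move=> [Cr <-]; rewrite mem_set.
  move=> v; split.
    have [->|v0] := eqVneq v 0; last by rewrite sv.
    rewrite (_ : _ @^-1` _ = ~` C n `|` (C n `&` (nearest d n \o f) @^-1` [set 0])).
      by apply: measurableU => //; exact: measurableC.
    apply/seteqP; split => r /=; rewrite /s.
      by case: ifPn => [/set_mem Cr h|/negP Cr _]; [right|left => h; apply/Cr/mem_set].
    by move=> [Cr|[Cr <-]]; [rewrite memNset|rewrite mem_set].
  move=> v0; rewrite sv//.
  apply: (@le_lt_trans _ _ (mu `[- n%:R, n%:R])).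
    apply: le_measure; rewrite ?inE//.
    - exact: measurableI.
    - by move=> r [_ [[]]].
  by rewrite lebesgue_measure_itv/=; case: ifP => _; rewrite ?ltry// -EFinB ltry.
have s_le n r : D r -> `|f r - s n r| <= `|f r|.
  move=> Dr; rewrite /s; case: ifPn => _; last by rewrite subr0.
  by have := nearest_le d n 0 (f r) (leq0n n); rewrite d0 subr0.
have s_cvg r : D r -> s n r @[n --> \oo] --> f r.
  move=> Dr; apply/cvgrPdist_lt => eps eps0; have [k fk] := dd (f r) eps eps0.
  (* Beyond [k] the point [d k] is among the candidates; beyond [|r|] the window contains [r]. *)
  exists (maxn k (Num.truncn `|r|).+1) => // n /=; rewrite geq_max => /andP[kn rn].
  rewrite /s mem_set; first exact: le_lt_trans (nearest_le d n k (f r) kn) fk.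
  split => //=; rewrite in_itv/= -ler_norml.
  by rewrite (le_trans (ltW (truncnS_gt _)))// ler_nat.
have dist_cvg : (\int[mu]_(r in D) (`|f r - s n r|)%:E)%E @[n --> \oo] --> 0%E.
  rewrite [X in _ --> X](_ : _ = (\int[mu]_(r in D) 0)%E); last by rewrite integral0.
  apply: (@dominated_cvg _ _ _ mu D mD _ _ (EFin \o (fun r => `|f r|))) => //.
  - move=> n; apply/measurable_EFinP; apply: weakly_measurable_norm.
    apply: weakly_measurableB => //.
    exact: integrable_simple_weakly_measurable.
  - move=> r Dr; apply: cvg_EFin; first exact: nearW.
    rewrite -(@normr0 _ X) -(subrr (f r)); apply: cvg_norm.
    by apply: cvgB; [exact: cvg_cst|exact: s_cvg].
  - by move=> n r Dr; rewrite /= lee_fin normr_id s_le.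
(* The value of the integral is produced weakly, as the vector representing [y |-> \int ip (f r) y];
   norm convergence to it is proved afterwards. *)
have [|||y|v [vE _ _]] := @functional_representation id
    (fun y => \int[mu]_(r in D) ip (f r) y) (\int[mu]_(r in D) `|f r|).
- by [].
- move=> a y z; under eq_Rintegral do rewrite ipDr ipZr.
  rewrite RintegralD//; first by rewrite RintegralZl//; exact: integrable_ip.
    by have := integrableZl mD a (integrable_ip y).
  exact: integrable_ip.
- by apply: Rintegral_ge0.
- rewrite (le_trans (le_normr_Rintegral mD (integrable_ip y)))//.
  rewrite -RintegralZr//; apply: le_Rintegral => //.
  + exact: (integrable_norm (integrable_ip y)).
  + have := integrableZl mD `|y| intf.
    by under eq_fun do rewrite /= muleC.
  + by move=> r _; exact: cauchy_schwarz.
exists v, s; split => //.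
have fin_cvg : fine (\int[mu]_(r in D) (`|f r - s n r|)%:E)%E @[n --> \oo] --> (0 : R).
  exact: (fine_cvg dist_cvg).
apply: (cvg_of_dist_le fin_cvg) => n.
apply: norm_le_of_ip.
  by rewrite /= fine_ge0// integral_ge0.
have := simple_integral_dist (simple_integral D (s n) - v) (s_simple n).
rewrite -vE -ipBl; exact: le_trans (ler_norm _).
Qed.

Lemma ip_bochner_integral y : separable_space X ->
  ip (bochner_integral D f) y = \int[mu]_(r in D) ip (f r) y.
Proof.
move=> /is_bochner_integral_exists/getPex[s [s_simple s_cvg dist_cvg int_cvg]].
rewrite -[get _]/(bochner_integral D f) in int_cvg.
have h : ip (simple_integral D (s n)) y @[n --> \oo] -->
  ip (bochner_integral D f) y by exact: cvg_ipl.
apply: (eq_of_cvg_dist h _ (fun n => simple_integral_dist y (s_simple n))).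
rewrite -(mul0r `|y|); apply: cvgM; last exact: cvg_cst.
exact: (fine_cvg dist_cvg).
Qed.

End integrable_function.
End bochner.

(** The hypothesis on [G] and [K] is the weak form of [G = K^* K]. It makes the integral symmetric
    and non-negative, and boundedness then follows from Hellinger-Toeplitz without an operator norm
    estimate. *)
Lemma bochner_quadratic_form (D : set TR) (G K : R -> X -> X) :
  separable_space X -> measurable D -> (forall r, D r -> linear (K r)) ->
  (forall r x y, D r -> ip (G r x) y = ip (K r x) (K r y)) ->
  (forall x, weakly_measurable D (G ^~ x)) ->
  (forall x, mu.-integrable D (EFin \o (fun r => `|G r x|))) ->
  let Q x := bochner_integral D (G ^~ x) in
  (forall x y, ip (Q x) y = \int[mu]_(r in D) ip (K r x) (K r y)) /\
  nonneg_selfadjoint ip Q.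
Proof.
move=> Xsep mD Kl GK mG iG Q.
have iK x y : mu.-integrable D (EFin \o (fun r => ip (K r x) (K r y))).
  apply: (eq_integrable mD _ _ _ (integrable_ip mD (mG x) (iG x) y)).
  by move=> r /set_mem Dr; rewrite /= GK.
have QE x y : ip (Q x) y = \int[mu]_(r in D) ip (K r x) (K r y).
  rewrite ip_bochner_integral//; apply: eq_Rintegral => r /set_mem Dr.
  exact: GK.
have Qs x y : ip (Q x) y = ip x (Q y).
  by rewrite (ipC x) !QE; apply: eq_Rintegral => r _; rewrite ipC.
have Ql : linear Q.
  move=> a u v; apply: ip_ext => z; rewrite ipDl ipZl !QE.
  rewrite -RintegralZl// -RintegralD//; last first.
    by have := integrableZl mD a (iK u z).
  apply: eq_Rintegral => r /set_mem Dr.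
  by rewrite Kl// ipDl ipZl.
split=> //; split => //; first exact: symmetric_bounded.
by move=> x; rewrite QE; apply: Rintegral_ge0 => r _; rewrite ip_norm sqr_ge0.
Qed.

(** * Covariance operators *)

Section evolution.
Context (X_separable : separable_space X).
Context (U : R -> R -> X -> X) (B : R -> X -> X).
Context (A1 : evolution_operator U) (A2_op : forall t, bounded_op (B t)).
Context (A2_sup : (ereal_sup (range (fun t => opnorm (B t))) < +oo)%E).
Context (A2_meas : strongly_measurable B).

(* The adjoint of [L = U(t,r) B(r)], so that [integrand] is [L L^*]. *)
Definition factor_adj t r := op_adjoint ip (B r) \o op_adjoint ip (U t r).

Definition integrand t r x := (U t r \o Qop ip B r \o op_adjoint ip (U t r)) x.

Lemma U_bounded {s t} : s <= t -> bounded_op (U t s).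
Proof. by case: A1 => h _ _ _; exact: h. Qed.

Lemma factor_adjP {t r} : r <= t -> is_adjoint (U t r \o B r) (factor_adj t r).
Proof.
by move=> rt; apply: is_adjoint_comp; apply: op_adjointP => //; exact: U_bounded.
Qed.

Lemma factor_adj_linear {t r} : r <= t -> linear (factor_adj t r).
Proof. by move=> /factor_adjP; exact: is_adjoint_linear. Qed.

Lemma ip_integrand t r x y : r <= t ->
  ip (integrand t r x) y = ip (factor_adj t r x) (factor_adj t r y).
Proof. by move=> rt; rewrite -factor_adjP. Qed.

Lemma B_uniform_bound : exists2 M, 0 < M & forall r x, `|B r x| <= M * `|x|.
Proof.
have := A2_sup; set S := ereal_sup _ => S_lty.
have BS r x : `|x| <= 1 -> ((`|B r x|)%:E <= S)%E.
  move=> x1; apply: (@le_trans _ _ (opnorm (B r))).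
    by apply: ereal_sup_ubound; exists x.
  by apply: ereal_sup_ubound; exists r.
have S0 : (0 <= S)%E.
  apply: le_trans (BS 0 0 _); first by rewrite lee_fin.
  by rewrite normr0.
have Sfin : S \is a fin_num by rewrite ge0_fin_numE.
exists (fine S + 1); first by rewrite ltr_wpDl// fine_ge0.
move=> r x; have [Bl _] := A2_op r.
have [->|x0] := eqVneq x 0; first by rewrite lin0// !normr0 mulr0.
have := BS r (`|x|^-1 *: x); rewrite normrZ normfV normr_id mulVf ?normr_eq0//.
move=> /(_ (lexx _)); rewrite (linZ _ Bl) normrZ normfV normr_id.
rewrite -(fineK Sfin) lee_fin ler_pdivrMl ?normr_gt0// mulrC => /le_trans; apply.
by rewrite ler_wpM2r// lerDl.
Qed.

Lemma U_cvg {t r} x : r <= t ->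
  U t q x @[q --> within `]-oo, t] (nbhs r)] --> U t r x.
Proof.
move=> rt; case: A1 => _ /(_ x)/subspace_continuousP/(_ (r, t) rt) h _ _.
apply: cvg_trans h => V /= hV.
have hc : (q, t) @[q --> nbhs r] --> nbhs (r, t).
  exact: (cvg_pair cvg_id (cvg_cst t)).
change (nbhs r [set q | (`]-oo, t]%classic : set R) q -> V (U t q x)]).
have hW : nbhs r [set q | q <= t -> V (U t q x)] by exact: (hc _ hV).
by apply: filterS hW => q /= h; rewrite in_itv.
Qed.

(** For each [x], [r |-> U t r x] is continuous on a compact interval, hence bounded;
    Banach-Steinhaus makes the bound uniform. *)
Lemma U_uniform_bound {s t} : s <= t ->
  exists2 C, 0 < C & forall r x, s <= r <= t -> `|U t r x| <= C * `|x|.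
Proof.
move=> st; pose F := [set U t r | r in `[s, t]].
have [||M FM] := @Banach_Steinhauss R X X F _ _ 1.
- move=> _ [r /= rst <-]; have rt : r <= t by move: rst; rewrite in_itv/= => /andP[].
  have [Ul Uc] := U_bounded rt; split => //.
  have [C C0 UC] := linear_continuous_bound _ Ul Uc.
  move=> c; exists (C * c) => x xc; apply: (le_trans (UC x)).
  by apply: ler_wpM2l => //; exact: ltW.
- move=> x; have [|c cst hc] := @EVT_max R (fun r => `|U t r x|) s t st.
    apply/subspace_continuousP => r /= rst; apply: cvg_norm.
    have rt : r <= t by move: rst; rewrite in_itv/= => /andP[].
    apply: cvg_trans (U_cvg x rt); apply: cvg_app.
    by apply: within_subset => q /=; rewrite !in_itv/= => /andP[].
  by exists `|U t c x| => _ [r rst <-]; exact: hc.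
exists (`|M| + 1); first by rewrite ltr_wpDl.
move=> r x rst; have rt : r <= t by case/andP: rst.
have [Ul _] := U_bounded rt.
have [->|x0] := eqVneq x 0; first by rewrite lin0// !normr0 mulr0.
have := FM (U t r) _ (`|x|^-1 *: x); rewrite normrZ normfV normr_id.
rewrite mulVf ?normr_eq0// => /(_ _ (lexx _)).
rewrite (linZ _ Ul) normrZ normfV normr_id ler_pdivrMl ?normr_gt0// mulrC.
move=> /(_ _)/le_trans; apply; first by exists r; rewrite //= in_itv.
by rewrite ler_wpM2r// (le_trans (ler_norm _))// lerDl.
Qed.

Lemma measurable_ip_B y z : measurable_fun [set: TR] (fun r => ip (B r y) z).
Proof.
apply: (measurability _ (RGenOInfty.measurableE R)) => _ [_ [a ->] <-].
pose S : set (g_sigma_algebraType (@open X)) := [set w | a < ip w z].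
have mS : measurable S.
  apply: sub_sigma_algebra; rewrite /S.
  rewrite (_ : [set _ | _] = (fun w => ip w z) @^-1` `]a, +oo[%classic).
    apply: open_comp => [w _|]; last exact: rray_open.
    by apply: (@cvg_ipl X (nbhs w) _ id).
  by apply/seteqP; split => w /=; rewrite in_itv/= andbT.
have := A2_meas y measurableT S mS.
rewrite (_ : _ @^-1` S = (fun r => ip (B r y) z) @^-1` `]a, +oo[%classic)//.
by apply/seteqP; split => r; rewrite /S /= in_itv/= andbT.
Qed.

Lemma measurable_ip_U t x z :
  measurable_fun (`]-oo, t] : set TR) (fun r => ip (U t r x) z).
Proof.
apply: subspace_continuous_measurable_fun; first exact: measurable_itv.
apply/subspace_continuousP => r; rewrite /= in_itv/= => rt.
by apply: cvg_ipl; exact: U_cvg.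
Qed.

(** Operator and argument both vary with [r]. Expanding [B r y] in the basis separates them into
    products of scalar functions, measurable for [B] and continuous for [U]. *)
Lemma measurable_ip_factor t x y :
  measurable_fun (`]-oo, t] : set TR) (fun r => ip (U t r (B r y)) x).
Proof.
apply: (@measurable_fun_cvg _ _ _ _
  (fun n r => \sum_(j < n) ip (B r y) (e j) * ip (U t r (e j)) x)).
  move=> n; apply: measurable_sum => j; apply: measurable_funM.
    apply: (measurable_funS measurableT) => //; exact: measurable_ip_B.
  exact: measurable_ip_U.
move=> r; rewrite /= in_itv/= => rt; have [Ul Uc] := U_bounded rt.
have h1 : U t r (partial_expansion n (B r y)) @[n --> \oo] --> U t r (B r y).
  exact: (cvg_comp _ _ (cvg_partial_expansion (B r y)) (Uc _)).
have h : ip (U t r (partial_expansion n (B r y))) x @[n --> \oo] -->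
  ip (U t r (B r y)) x by exact: cvg_ipl.
apply: cvg_trans h; apply: near_eq_cvg; apply: nearW => n.
rewrite (lin_sum _ Ul) ip_suml.
by apply: eq_bigr => j _; rewrite /= (linZ _ Ul) ipZl.
Qed.

Lemma weakly_measurable_factor_adj t x :
  weakly_measurable `]-oo, t] (fun r => factor_adj t r x).
Proof.
move=> y; apply: eq_measurable_fun (measurable_ip_factor t x y) => r /set_mem /=.
by rewrite in_itv/= => rt; rewrite -[LHS]/(ip ((U t r \o B r) y) x) factor_adjP// ipC.
Qed.

Lemma weakly_measurable_integrand t x :
  weakly_measurable `]-oo, t] (integrand t ^~ x).
Proof.
move=> y; have := weakly_measurable_ip (weakly_measurable_factor_adj t x)
  (weakly_measurable_factor_adj t y).
apply: eq_measurable_fun => r /set_mem /=.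
by rewrite in_itv/= => rt; rewrite ip_integrand.
Qed.

Lemma integrable_integrand_fin {s t} x : s < t ->
  mu.-integrable `[s, t] (EFin \o (fun r => `|integrand t r x|)).
Proof.
move=> st; have [M M0 BM] := B_uniform_bound.
have [C C0 UC] := U_uniform_bound (ltW st).
have sub : `[s, t] `<=` (`]-oo, t]%classic : set TR) by move=> r /=; rewrite !in_itv/= => /andP[].
have mst : measurable (`[s, t] : set TR) by exact: measurable_itv.
apply: (@le_integrable _ _ _ mu _ mst _ (cst (C * (M * (M * (C * `|x|))))%:E)).
- apply/measurable_EFinP.
  apply: (@measurable_funS _ _ _ _ (`]-oo, t] : set TR)) => //.
  by apply: weakly_measurable_norm; exact: weakly_measurable_integrand.
- move=> r /=; rewrite in_itv/= => rst; have rt : r <= t by case/andP: rst.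
  rewrite lee_fin normr_id [leRHS]ger0_norm; last first.
    by rewrite !(mulr_ge0 (ltW _)).
  apply: (le_trans (UC _ _ rst)); apply: ler_wpM2l; first exact: ltW.
  apply: (le_trans (BM _ _)); apply: ler_wpM2l; first exact: ltW.
  apply: (le_trans (is_adjoint_norm (ltW M0) (op_adjointP (A2_op r)) (BM r) _)).
  apply: ler_wpM2l; first exact: ltW.
  apply: (is_adjoint_norm (ltW C0) (op_adjointP (U_bounded rt))) => z.
  exact: UC.
- apply/integrableP; split; first exact: measurable_cst.
  rewrite integral_cst//= lebesgue_measure_itv/= lte_fin st -EFinB -EFinM ltry//.
Qed.

Lemma Qfin_form {s t} : s < t ->
  (forall x y, ip (Qfin ip U B t s x) y =
    \int[mu]_(r in `[s, t]) ip (factor_adj t r x) (factor_adj t r y)) /\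
  nonneg_selfadjoint ip (Qfin ip U B t s).
Proof.
move=> st; apply: bochner_quadratic_form => //.
- move=> r /=; rewrite in_itv/= => /andP[_]; exact: factor_adj_linear.
- move=> r x y /=; rewrite in_itv/= => /andP[_]; exact: ip_integrand.
- move=> x y; apply: measurable_funS (weakly_measurable_integrand t x y) => //.
  by move=> r /=; rewrite !in_itv/= => /andP[].
- by move=> x; exact: integrable_integrand_fin.
Qed.

(** * The integral over a half-line and its splitting *)

Section infinite_horizon.
Context (A4_sup : forall t, (ereal_sup [set op_trace ip (Qfin ip U B t s) |
  s in [set s : R | (s < t)%R]] < +oo)%E).
Context (e_trace : forall A n, (forall x, 0 <= ip (A x) x) ->
  ((\sum_(i < n) ip (A (e i)) (e i))%:E <= op_trace ip A)%E).

Lemma partial_trace_bound t : exists2 M, 0 <= M &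
  forall s n, s < t -> \sum_(i < n) ip (Qfin ip U B t s (e i)) (e i) <= M.
Proof.
have := A4_sup t; set S := ereal_sup _ => S_lty.
have QS s n : s < t ->
    ((\sum_(i < n) ip (Qfin ip U B t s (e i)) (e i))%:E <= S)%E.
  move=> st; apply: (@le_trans _ _ (op_trace ip (Qfin ip U B t s))).
    by apply: e_trace; have [_ []] := Qfin_form st.
  by apply: ereal_sup_ubound; exists s.
have S0 : (0 <= S)%E.
  have lt1 : t - 1 < t by rewrite ltrBlDr ltrDl.
  by have := QS _ 0 lt1; rewrite big_ord0.
have Sfin : S \is a fin_num by rewrite ge0_fin_numE.
exists (fine S); first exact: fine_ge0.
by move=> s n st; rewrite -lee_fin fineK// QS.
Qed.

(* Since [L L^*] is bounded by its trace, [|L L^* x|] is dominated by the sum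
   of the [|L^* e_i|^2 |x|]. *)
Lemma integrand_norm_le t r x c : r <= t ->
  (forall n, (\sum_(i < n) `|factor_adj t r (e i)| ^+ 2) * `|x| <= c) ->
  `|integrand t r x| <= c.
Proof.
move=> rt hc; have LP := factor_adjP rt.
have [x0|x0] := eqVneq x 0.
  have := hc 0; rewrite big_ord0 mul0r => c0.
  have -> : integrand t r x = 0; last by rewrite normr0.
  apply: ip_ext => z; rewrite ip_integrand// x0 lin0; first by rewrite !ip0l.
  exact: factor_adj_linear.
have {}hc n : \sum_(i < n) `|factor_adj t r (e i)| ^+ 2 <= c / `|x|.
  by rewrite ler_pdivlMr ?normr_gt0.
set k := c / `|x| in hc.
have k0 : 0 <= k by have := hc 0; rewrite big_ord0.
(* The Hilbert-Schmidt bound: the coefficients of [L z] are [ip z (L^* e_i)]. Taking [z = L^* x]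
   below gives [|L L^* x|^2 <= k ip (L L^* x) x], and one factor [|L L^* x|] cancels. *)
have Lk z : `|(U t r \o B r) z| ^+ 2 <= k * `|z| ^+ 2.
  have h := parseval ((U t r \o B r) z) ((U t r \o B r) z).
  rewrite -ip_norm; apply: (ler_cvg_to h (cvg_cst _)); apply: nearW => n.
  apply: (@le_trans _ _ (\sum_(i < n) `|factor_adj t r (e i)| ^+ 2 * `|z| ^+ 2)).
    apply: ler_sum => i _; rewrite LP -expr2 -exprMn mulrC.
    rewrite -ler_sqrt ?sqr_ge0// !sqrtr_sqr normrM !normr_id.
    exact: cauchy_schwarz.
  by rewrite -mulr_suml ler_wpM2r ?sqr_ge0.
have hG : `|integrand t r x| ^+ 2 <= k * (`|integrand t r x| * `|x|).
  apply: (le_trans (Lk (factor_adj t r x))); rewrite ler_wpM2l//.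
  by rewrite -ip_norm -ip_integrand// ip_le_norm.
have [->|G0] := eqVneq `|integrand t r x| 0.
  by have := mulr_ge0 k0 (normr_ge0 x); rewrite /k mulfVK ?normr_eq0.
move: hG; rewrite expr2 mulrCA ler_pM2l; last by rewrite lt0r G0 normr_ge0.
by rewrite /k mulfVK ?normr_eq0.
Qed.

Lemma integrable_integrand t x :
  mu.-integrable `]-oo, t] (EFin \o (fun r => `|integrand t r x|)).
Proof.
have [M M0 QM] := partial_trace_bound t.
have mD : measurable (`]-oo, t] : set TR) by exact: measurable_itv.
(* One index drives both the interval and the number of basis vectors, so a single monotone
   convergence suffices; [k.+1] keeps the interval nondegenerate at [k = 0]. *)
pose C k : set TR := `[t - k.+1%:R, t]%classic.
have mC k : measurable (C k) by exact: measurable_itv.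
have lt_C k : t - k.+1%:R < t by rewrite ltrBlDr ltrDl.
have CD k : C k `<=` `]-oo, t] by move=> r /=; rewrite !in_itv/= => /andP[].
pose a k r := (\sum_(i < k) `|factor_adj t r (e i)| ^+ 2) * `|x|.
have a0 k r : 0 <= a k r by rewrite mulr_ge0// sumr_ge0// => i _; exact: sqr_ge0.
have a_incr k l r : (k <= l)%N -> a k r <= a l r.
  move=> kl; rewrite ler_wpM2r// -(subnKC kl) big_split_ord/= lerDl.
  by apply: sumr_ge0 => i _; exact: sqr_ge0.
have ma k : measurable_fun (`]-oo, t] : set TR) (a k).
  apply: measurable_funM => //; apply: measurable_sum => i.
  apply: measurable_funX; apply: weakly_measurable_norm.
  exact: weakly_measurable_factor_adj.
pose h k : TR -> \bar R := (EFin \o a k) \_ (C k).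
have h0 k r : (0 <= h k r)%E.
  by rewrite /h patchE; case: ifP => // _; rewrite lee_fin.
have mh k : measurable_fun (`]-oo, t] : set TR) (h k).
  rewrite /h; apply/(measurable_restrict (EFin \o a k) (mC k) mD).
  apply/measurable_EFinP; apply: measurable_funS (ma k) => //.
have h_incr r : {homo h^~ r : n m / (n <= m)%N >-> (n <= m)%E}.
  move=> k l kl; rewrite /h !patchE; case: ifPn => [/set_mem Cr|_]; last exact: h0.
  rewrite mem_set ?lee_fin ?a_incr//.
  move: Cr; rewrite /C/= !in_itv/= => /andP[+ ->]; rewrite andbT.
  by apply: le_trans; rewrite lerB// ler_nat.
have int_h k : (\int[mu]_(r in `]-oo, t]) h k r <= (`|x| * M)%:E)%E.
  rewrite /h -integral_mkcondr (setIidr (CD k)).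
  have [QE _] := Qfin_form (lt_C k); set Q := Qfin _ _ _ _ _ in QE.
  have QiE i : (\int[mu]_(r in C k) (`|factor_adj t r (e i)| ^+ 2 * `|x|)%:E)%E =
      (`|x| * ip (Q (e i)) (e i))%:E.
    rewrite -ipZr QE /Rintegral fineK.
      apply: eq_integral => r /set_mem /CD; rewrite /= in_itv/= => rt.
      by rewrite (linZ _ (factor_adj_linear rt)) ipZr ip_norm mulrC.
    apply: integrable_fin_num => //.
    have wm : weakly_measurable (C k) (integrand t ^~ (e i)).
      move=> y.
      exact: (measurable_funS mD (CD k) (weakly_measurable_integrand t (e i) y)).
    apply: (eq_integrable (mC k) _ _ _ (integrable_ip (mC k) wm
      (integrable_integrand_fin (e i) (lt_C k)) (`|x| *: e i))).
    move=> r /set_mem /CD; rewrite /= in_itv/= => rt; by rewrite ip_integrand.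
  rewrite (eq_integral (fun r : TR =>
    (\sum_(i < k) (`|factor_adj t r (e i)| ^+ 2 * `|x|)%:E)%E)); last first.
    by move=> r _; rewrite /a /= mulr_suml sumEFin.
  rewrite ge0_integral_sum//; last first.
    move=> i; apply/measurable_EFinP; apply: measurable_funM => //.
    apply: measurable_funX; apply: (measurable_funS mD (CD k)).
    by apply: weakly_measurable_norm; exact: weakly_measurable_factor_adj.
  rewrite (eq_bigr (fun i : 'I_k => (`|x| * ip (Q (e i)) (e i))%:E)).
    by rewrite sumEFin lee_fin -mulr_sumr ler_wpM2l// QM.
  by move=> i _; exact: QiE.
have h_lim := @cvg_monotone_convergence _ _ _ mu _ mD _ mh
  (fun n r _ => h0 n r) (fun r _ => h_incr r).
have int_lim : (\int[mu]_(r in `]-oo, t]) limn (h^~ r) <= (`|x| * M)%:E)%E.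
  rewrite -(cvg_lim _ h_lim)//; apply: lime_le; first exact: (cvgP _ h_lim).
  exact: nearW.
apply/integrableP; split.
  apply/measurable_EFinP; apply: weakly_measurable_norm.
  exact: weakly_measurable_integrand.
apply: le_lt_trans (le_lt_trans int_lim (ltry _)).
apply: ge0_le_integral => //.
- apply/measurable_EFinP; apply: measurableT_comp => //.
  apply: weakly_measurable_norm; exact: weakly_measurable_integrand.
- by apply: (emeasurable_fun_cvg _ _ mh) => r _; exact: ereal_nondecreasing_is_cvgn.
move=> r /=; rewrite in_itv/= normr_id => rt.
have h_le k : (h k r <= limn (h^~ r))%E.
  rewrite (cvg_lim _ (ereal_nondecreasing_cvgn (h_incr r)))//.
  by apply: ereal_sup_ubound; exists k.
(* The limit may be infinite at some [r], where the domination is trivial; where it is finite it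
   bounds every partial trace at [r]. *)
case E : (limn (h^~ r)) h_le => [c| |] h_le.
- rewrite lee_fin; apply: integrand_norm_le => // n.
  pose k := maxn n (Num.truncn (t - r)).+1.
  apply: (le_trans (a_incr n k r (leq_maxl _ _))); rewrite -lee_fin.
  apply: le_trans (h_le k); rewrite /h patchE mem_set// /C/= in_itv/= rt andbT.
  rewrite lerBlDr -lerBlDl (le_trans (ltW (truncnS_gt _)))// ler_nat.
  by rewrite leqW// leq_maxr.
- by rewrite leey.
- by have := le_trans (h0 0 r) (h_le 0).
Qed.

Lemma Qinf_form t :
  (forall x y, ip (Qinf ip U B t x) y =
    \int[mu]_(r in `]-oo, t]) ip (factor_adj t r x) (factor_adj t r y)) /\
  nonneg_selfadjoint ip (Qinf ip U B t).
Proof.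
apply: bochner_quadratic_form => //.
- move=> r /=; rewrite in_itv/=; exact: factor_adj_linear.
- move=> r x y /=; rewrite in_itv/=; exact: ip_integrand.
- exact: weakly_measurable_integrand.
- exact: integrable_integrand.
Qed.

Lemma factor_adj_comp {s t r} x : r <= s -> s <= t ->
  factor_adj t r x = factor_adj s r (op_adjoint ip (U t s) x).
Proof.
move=> rs st; rewrite /factor_adj /=; congr (op_adjoint ip (B r) _).
have h := is_adjoint_comp (op_adjointP (U_bounded st)) (op_adjointP (U_bounded rs)).
case: A1 => _ _ _ /(_ r s t rs st) UE; rewrite UE in h.
exact: (is_adjoint_unique (op_adjointP (U_bounded (le_trans rs st))) h).
Qed.

Lemma Qinf_decomposition {s t} x y : s < t -> ip (Qinf ip U B t x) y =
  ip (Qfin ip U B t s x) y +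
  ip (Qinf ip U B s (op_adjoint ip (U t s) x)) (op_adjoint ip (U t s) y).
Proof.
move=> st; have [-> _] := Qinf_form t; have [-> _] := Qinf_form s.
have [-> _] := Qfin_form st.
have mD : measurable (`]-oo, t] : set TR) by exact: measurable_itv.
have int_t : mu.-integrable `]-oo, t]
    (EFin \o (fun r => ip (factor_adj t r x) (factor_adj t r y))).
  apply: (eq_integrable mD _ _ _ (integrable_ip mD
    (weakly_measurable_integrand t x) (integrable_integrand t x) y)).
  by move=> r /set_mem /=; rewrite in_itv/= => rt; rewrite ip_integrand.
have := Rintegral_itvB (x := s) int_t isT; rewrite bnd_simp (ltW st) => /(_ isT).
rewrite Rintegral_itv_obnd_cbnd; last first.
  apply: (integrableS mD _ _ int_t) => //.
  by move=> r /=; rewrite !in_itv/= => /andP[].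
move=> <-; rewrite -[LHS](subrK (\int[mu]_(r in `]-oo, s])
  ip (factor_adj t r x) (factor_adj t r y))); congr (_ + _).
apply: eq_Rintegral => r /set_mem /=; rewrite in_itv/= => rs.
by rewrite !(factor_adj_comp _ rs (ltW st)).
Qed.

(** A zero integral gives [L^* x = 0] only for almost every [r]. If [y = B(t)^* x] were nonzero,
    [ip (U t r (B r y)) x = ip y (L^* x)] would tend to [|y|^2 > 0] as [r] increases to [t], hence
    be positive on an interval ending at [t], which is not a null set. *)
Lemma Qfin_kernel s t x : s < t -> strongly_continuous B ->
  ip (Qfin ip U B t s x) x = 0 -> Qop ip B t x = 0.
Proof.
move=> st Bc; have [-> _] := Qfin_form st => int0.
have mD : measurable (`]-oo, t] : set TR) by exact: measurable_itv.
have mst : measurable (`[s, t] : set TR) by exact: measurable_itv.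
have sub : `[s, t] `<=` (`]-oo, t]%classic : set TR).
  by move=> r /=; rewrite !in_itv/= => /andP[].
pose g (r : TR) := ip (factor_adj t r x) (factor_adj t r x).
have mg : measurable_fun (`[s, t] : set TR) g.
  apply: (measurable_funS mD sub).
  by apply: weakly_measurable_ip; exact: weakly_measurable_factor_adj.
have ig : mu.-integrable `[s, t] (EFin \o g).
  apply: (eq_integrable mst _ _ _ (integrable_ip mst
    _ (integrable_integrand_fin x st) x)).
    by move=> r /set_mem /sub /=; rewrite in_itv/= => rt; rewrite ip_integrand.
  by move=> y; exact: (measurable_funS mD sub (weakly_measurable_integrand t x y)).
have g0 r : 0 <= g r by rewrite /g ip_norm sqr_ge0.
have : (\int[mu]_(r in `[s, t]) `|(g r)%:E| = 0)%E.
  rewrite (eq_integral (EFin \o g)); last by move=> r _ /=; rewrite ger0_norm.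
  rewrite -[LHS]fineK; first by rewrite -[fine _]/(\int[mu]_(r in `[s, t]) g r) int0.
  exact: integrable_fin_num.
move/(ae_eq_integral_abs mu mst ((measurable_EFinP _ _).2 mg)) => [N [mN N0 gN]].
apply/eqP/negPn/negP => Qx0.
pose y := op_adjoint ip (B t) x.
have Bl r : linear (B r) by have [] := A2_op r.
have y0 : y != 0 by apply: contraNneq Qx0 => y0; rewrite /Qop /= -/y y0 lin0.
have [C C0 UC] := U_uniform_bound (ltW st).
have cvgUB : U t r (B r y) @[r --> t^'-] --> B t y.
  have Utt : U t t = id by case: A1.
  have h1 : U t r (B t y) @[r --> t^'-] --> B t y.
    rewrite -[X in _ --> X]/(id (B t y)) -Utt.
    apply: cvg_trans (U_cvg (B t y) (lexx t)); apply: cvg_app.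
    by apply: within_subset => r /=; rewrite in_itv/= => /ltW.
  have h2 : C * `|B r y - B t y| @[r --> t^'-] --> 0.
    rewrite -(mulr0 C); apply: cvgM; first exact: cvg_cst.
    rewrite -(@normr0 _ X) -(subrr (B t y)); apply: cvg_norm.
    apply: cvgB; last exact: cvg_cst.
    by apply: cvg_at_left_filter; exact: Bc.
  (* The bound on [U t r] uniform in [r] is what allows [B r y] to vary along with the operator. *)
  have h3 : U t r (B r y - B t y) @[r --> t^'-] --> 0.
    apply: norm_cvg0; apply: (squeeze_cvgr _ (cvg_cst 0) h2); near=> r.
    rewrite normr_ge0/=; apply: UC; apply/andP; split; apply: ltW; near: r.
      exact: nbhs_left_gt.
    exact: nbhs_left_lt.
  have h4 : U t r (B r y - B t y) + U t r (B t y) @[r --> t^'-] --> B t y.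
    by rewrite -[X in _ --> X]add0r; exact: cvgD.
  apply: cvg_trans h4; apply: near_eq_cvg; near=> r.
  have rt : r <= t by apply: ltW; near: r; exact: nbhs_left_lt.
  by have [Ul _] := U_bounded rt; rewrite -(linD _ Ul) subrK.
have ip_pos : 0 < ip (B t y) x.
  by rewrite (op_adjointP (A2_op t)) ip_norm exprn_gt0// normr_gt0.
have : \forall r \near t^'-, 0 < ip (U t r (B r y)) x.
  have h : ip (U t r (B r y)) x @[r --> t^'-] --> ip (B t y) x by exact: cvg_ipl.
  exact: (cvgr_gt _ h).
have ts : \forall r \near t^'-, s < r by exact: nbhs_left_gt.
move=> /(filterI ts)[d /= d0 hd].
pose I : set TR := `]t - d, t[%classic.
have IN : I `<=` N.
  move=> r; rewrite /I /= in_itv/= => /andP[dr rt]; apply: gN => /= h.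
  have [sr] : s < r /\ 0 < ip (U t r (B r y)) x.
    apply: hd => //=; rewrite ger0_norm ?subr_ge0 ?(ltW rt)//.
    by rewrite ltrBlDr -ltrBlDl.
  have := h _; rewrite in_itv/= (ltW sr) (ltW rt) => /(_ isT)[].
  rewrite /g ip_norm => /eqP; rewrite sqrf_eq0 normr_eq0 => /eqP fx0.
  rewrite -[ip _ x]/(ip ((U t r \o B r) y) x) (factor_adjP (ltW rt)) fx0 ip0r.
  by rewrite ltxx.
have : (mu I <= mu N)%E by apply: le_measure; rewrite ?inE//; exact: measurable_itv.
rewrite N0 lebesgue_measure_itv/= lte_fin ltrBlDr ltrDl d0 -EFinB opprB addrC subrK lee_fin.
by rewrite leNgt d0.
Unshelve. all: by end_near. Qed.

Lemma Qinf_sqrt_decomposition s t x : s < t ->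
  `|sqrt_op ip (Qinf ip U B t) x| ^+ 2 =
  `|sqrt_op ip (Qfin ip U B t s) x| ^+ 2 +
  `|sqrt_op ip (Qinf ip U B s) (op_adjoint ip (U t s) x)| ^+ 2.
Proof.
have sqrt_norm A z : nonneg_selfadjoint ip A -> `|sqrt_op ip A z| ^+ 2 = ip (A z) z.
  by move=> /sqrt_opP[[_ Ss _] SS]; rewrite -ip_norm -Ss SS.
move=> st; rewrite !sqrt_norm; first exact: Qinf_decomposition.
- exact: (Qinf_form s).2.
- exact: (Qfin_form st).2.
- exact: (Qinf_form t).2.
Qed.

End infinite_horizon.
End evolution.
End expansion.
End hilbert.

(** * Comparison of ranges *)

Section range_comparison.
Context {R : realType} {X : completeNormedModType R}.
Context (ip : {dot X for @idfun R}).
Context (ip_norm : forall x : X, ip x x = `|x| ^+ 2).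

Lemma range_inclusion {S T T' : X -> X} {c : R} : nonneg_selfadjoint ip S ->
  is_adjoint ip T T' -> 0 <= c -> (forall x, `|T' x| <= c * `|S x|) ->
  forall z, S (pseudo_inv ip S (T z)) = T z /\
    `|pseudo_inv ip S (T z)| <= c * `|z|.
Proof.
move=> hS TT' c0 hc z.
apply: (pseudo_inv_exists ip ip_norm) => // [|x]; first exact: mulr_ge0.
rewrite TT' (le_trans (cauchy_schwarz ip ip_norm _ _))// mulrC mulrAC.
by rewrite ler_wpM2r.
Qed.

(** The converse half of Douglas' lemma. If [T y = S w], then [ip (T x) y = ip (S x) w], so the
    vectors [T x] with [|S x| <= 1] are weakly bounded, hence bounded. *)
Lemma range_inclusion_bound {S T : X -> X} :
  nonneg_selfadjoint ip S -> nonneg_selfadjoint ip T ->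
  range T `<=` range S -> exists2 K, 0 < K & forall x, `|T x| <= K * `|S x|.
Proof.
move=> [[Sl _] Ss _] [[Tl _] Ts _] TS.
have [|K K0 FK] := ip_uniform_bound ip ip_norm (T @` [set x | `|S x| <= 1]).
  move=> y; have [w _ wE] := TS _ (imageT T y).
  exists `|w| => _ [x /= x1 <-]; rewrite Ts -wE -Ss.
  rewrite (le_trans (cauchy_schwarz ip ip_norm _ _))//.
  by rewrite ler_piMl.
have TK a x : `|S (a *: x)| <= 1 -> `|a| * `|T x| <= K.
  by move=> h; rewrite -normrZ -(linZ _ Tl); apply: FK; exists (a *: x).
exists K => // x; have [Sx|Sx] := eqVneq (S x) 0.
  rewrite Sx normr0 mulr0 leNgt; apply/negP => Tx.
  (* On the kernel of [S] scaling is free; this factor would give [K + 1 <= K]. *)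
  have := TK ((K + 1) / `|T x|) x.
  rewrite (linZ _ Sl) Sx scaler0 normr0 ler01 => /(_ isT).
  rewrite ger0_norm ?mulfVK ?lt0r_neq0// ?divr_ge0 ?addr_ge0 ?(ltW K0)//.
  by rewrite gerDl ler10.
have := TK (`|S x|^-1) x; rewrite (linZ _ Sl) normrZ normfV normr_id.
rewrite mulVf ?normr_eq0// => /(_ (lexx _)).
by rewrite ler_pdivrMl ?normr_gt0// mulrC.
Qed.

(** * Consequences of the splitting of norms *)

Context {St Sts Ss V V' : X -> X}.
Context (St_sa : nonneg_selfadjoint ip St) (Sts_sa : nonneg_selfadjoint ip Sts).
Context (Ss_sa : nonneg_selfadjoint ip Ss) (VV' : is_adjoint ip V V').
Context (V_lin : linear V).
Context (decomposition : forall x,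
  `|St x| ^+ 2 = `|Sts x| ^+ 2 + `|Ss (V' x)| ^+ 2).

Let nrm (S : X -> X) h := `|pseudo_inv ip S h|.

Let VSs_adjoint : is_adjoint ip (V \o Ss) (Ss \o V').
Proof. by apply: is_adjoint_comp => // x y; case: Ss_sa => _ ->. Qed.

Let Sts_adjoint : is_adjoint ip Sts Sts.
Proof. by case: Sts_sa => _ ? _. Qed.

Let St_adjoint : is_adjoint ip St St.
Proof. by case: St_sa => _ ? _. Qed.

Let Sts_le x : `|Sts x| <= 1 * `|St x|.
Proof.
by rewrite mul1r -(@ler_pXn2r _ 2) ?nnegrE// decomposition lerDl sqr_ge0.
Qed.

Let SsV'_le x : `|(Ss \o V') x| <= 1 * `|St x|.
Proof.
by rewrite mul1r -(@ler_pXn2r _ 2) ?nnegrE// decomposition lerDr sqr_ge0.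
Qed.

Lemma range_sub_of_decomposition : range Sts `<=` range St.
Proof.
move=> _ [z _ <-]; exists (pseudo_inv ip St (Sts z)) => //.
exact: (range_inclusion St_sa Sts_adjoint ler01 Sts_le z).1.
Qed.

Lemma opnorm_embedding_le1 : (opnorm_on (range Sts) (nrm Sts) (nrm St) id <= 1)%E.
Proof.
apply: ge_ereal_sup => _ [_ [[z _ <-] z1] <-]; rewrite lee_fin /nrm.
have [zE _] := pseudo_inv_apply ip ip_norm Sts z Sts_sa; rewrite -zE.
apply: (le_trans (range_inclusion St_sa Sts_adjoint ler01 Sts_le _).2).
by rewrite mul1r.
Qed.

Lemma kernel_sub_of_decomposition : op_ker St `<=` op_ker Sts.
Proof.
move=> x; rewrite /op_ker /= => Sx; apply/eqP; rewrite -normr_le0.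
by rewrite (le_trans (Sts_le x))// Sx normr0 mulr0.
Qed.

Let VSs_range z : St (pseudo_inv ip St (V (Ss z))) = V (Ss z).
Proof. exact: (range_inclusion St_sa VSs_adjoint ler01 SsV'_le z).1. Qed.

Lemma range_image_of_decomposition h : range Ss h -> range St (V h).
Proof. by move=> [z _ <-]; exists (pseudo_inv ip St (V (Ss z))). Qed.

(** Replacing [z] by [pseudo_inv ip Ss (Ss z)] keeps [Ss z] and does not increase the norm, so [Ss]
    carries the unit ball of [X] onto that of its range. *)
Lemma opnorm_conj : opnorm_on (range Ss) (nrm Ss) (nrm St) V =
  opnorm (pseudo_inv ip St \o V \o Ss).
Proof.
apply/eqP; rewrite eq_le; apply/andP; split; apply: ge_ereal_sup.
  move=> _ [_ [[z _ <-] z1] <-].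
  have [zE _] := pseudo_inv_apply ip ip_norm Ss z Ss_sa.
  apply: ereal_sup_ubound; exists (pseudo_inv ip Ss (Ss z)) => //=.
  by rewrite zE.
move=> _ [z [_ z1] <-]; apply: ereal_sup_ubound; exists (Ss z) => //; split.
  by exists z.
by rewrite (le_trans _ z1)// (pseudo_inv_apply ip ip_norm Ss z Ss_sa).2.
Qed.

Let opnorm_le c : 0 <= c -> (forall x, `|(Ss \o V') x| <= c * `|St x|) ->
  (opnorm (pseudo_inv ip St \o V \o Ss) <= c%:E)%E.
Proof.
move=> c0 hc; apply: ge_ereal_sup => _ [z [_ z1] <-]; rewrite lee_fin.
apply: (le_trans (range_inclusion St_sa VSs_adjoint c0 hc z).2).
by rewrite ler_piMr.
Qed.

Lemma opnorm_conj_le1 : (opnorm (pseudo_inv ip St \o V \o Ss) <= 1)%E.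
Proof. exact: opnorm_le. Qed.

Lemma opnorm_lt1_range : (opnorm (pseudo_inv ip St \o V \o Ss) < 1)%E ->
  range St `<=` range Sts.
Proof.
set N := opnorm _ => N1.
have NP z : `|z| <= 1 -> ((`|pseudo_inv ip St (V (Ss z))|)%:E <= N)%E.
  by move=> z1; apply: ereal_sup_ubound; exists z.
have N0 : (0 <= N)%E.
  by apply: le_trans (NP 0 _); rewrite ?lee_fin ?normr0.
have Nfin : N \is a fin_num by rewrite ge0_fin_numE// (lt_trans N1)// ltry.
pose c := fine N.
have c0 : 0 <= c by exact: fine_ge0.
have c1 : c < 1 by rewrite -lte_fin fineK.
have Ss_lin : linear Ss by case: Ss_sa => -[].
have ipV z x : ip (V (Ss z)) x <= c * `|z| * `|St x|.
  have [->|z0] := eqVneq z 0.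
    by rewrite lin0// lin0// ip0l normr0 mulr0 mul0r.
  have := NP (`|z|^-1 *: z); rewrite normrZ normfV normr_id.
  rewrite mulVf ?normr_eq0// => /(_ (lexx _)); rewrite -(fineK Nfin) lee_fin -/c.
  set p := pseudo_inv _ _ _ => pc.
  have : ip (St p) x <= c * `|St x|.
    rewrite St_adjoint (le_trans (ip_le_norm ip ip_norm _ _))//.
    by rewrite ler_wpM2r.
  rewrite /p VSs_range (linZ _ Ss_lin) (linZ _ V_lin) ipZl.
  by rewrite ler_pdivrMl ?normr_gt0// mulrA (mulrC `|z|).
(* Duality: [ipV] at [z = Ss (V' x)] has the square of the norm of [z] on its left-hand side. *)
have SsV'_c x : `|Ss (V' x)| <= c * `|St x|.
  apply: (norm_le_of_ip ip ip_norm); first exact: mulr_ge0.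
  have := ipV (Ss (V' x)) x; rewrite mulrAC; apply: le_trans.
  by rewrite -[leRHS]/(ip ((V \o Ss) (Ss (V' x))) x) VSs_adjoint.
(* The splitting gives the factor [1 - c^2], which is at least [(1 - c)^2]; the weaker constant
   avoids a square root. *)
have Sts_ge x : `|St x| <= (1 - c)^-1 * `|Sts x|.
  rewrite ler_pdivlMl ?subr_gt0// -(@ler_pXn2r _ 2) ?nnegrE ?mulr_ge0 ?subr_ge0 ?(ltW c1)//.
  have := decomposition x; have := SsV'_c x.
  have := normr_ge0 (Ss (V' x)); have := normr_ge0 (St x).
  set a := `|St x|; set b := `|Ss _|; set d := `|Sts x| ^+ 2.
  move=> a0 b0 bca dE.
  have : b ^+ 2 <= c ^+ 2 * a ^+ 2 by rewrite -exprMn ler_pXn2r ?nnegrE// mulr_ge0.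
  have : 0 <= c * (1 - c) * a ^+ 2.
    by rewrite !mulr_ge0 ?subr_ge0 ?sqr_ge0// ltW.
  rewrite exprMn; nra.
move=> _ [z _ <-]; exists (pseudo_inv ip Sts (St z)) => //.
have c'0 : 0 <= (1 - c)^-1 by rewrite invr_ge0 subr_ge0 ltW.
exact: (range_inclusion Sts_sa St_adjoint c'0 Sts_ge z).1.
Qed.

Lemma range_opnorm_lt1 : range St `<=` range Sts ->
  (opnorm (pseudo_inv ip St \o V \o Ss) < 1)%E.
Proof.
move=> /(range_inclusion_bound Sts_sa St_sa)[K K0 StK].
(* [K + 1] in place of [K] ensures [k <= 1], so that [1 - k / 2] below is non-negative. *)
pose k := (K + 1) ^- 2.
have k0 : 0 < k by rewrite invr_gt0 exprn_gt0// addr_gt0.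
have k1 : k <= 1 by rewrite invf_le1 ?exprn_gt0 ?addr_gt0// expr_ge1 ?lerDr ?addr_ge0 ?ltW.
have kSt x : k * `|St x| ^+ 2 <= `|Sts x| ^+ 2.
  rewrite ler_pdivrMl ?exprn_gt0 ?addr_gt0// -exprMn.
  rewrite ler_pXn2r ?nnegrE ?mulr_ge0 ?addr_ge0 ?(ltW K0)//.
  by rewrite (le_trans (StK x))// ler_wpM2r// lerDl.
(* The sharp bound would be the square root of [1 - k]; it is at most [1 - k / 2], since
   [(1 - k / 2)^2 = 1 - k + (k / 2)^2]. *)
apply: (@le_lt_trans _ _ (1 - k / 2)%:E); last first.
  by rewrite lte_fin ltrBlDr ltrDl divr_gt0.
apply: opnorm_le => [|x]; first lra.
rewrite -(@ler_pXn2r _ 2) ?nnegrE//; last by rewrite mulr_ge0//; lra.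
have := decomposition x; have := kSt x; have := sqr_ge0 `|St x|.
rewrite exprMn /=; set a := `|St x| ^+ 2; set b := `|Ss _| ^+ 2 => a0 ka aE.
have : 0 <= (k / 2) ^+ 2 * a by rewrite mulr_ge0// sqr_ge0.
nra.
Qed.

End range_comparison.

Theorem proposition5p3 (R : realType) (X : completeNormedModType R)
  (ip : {dot X for @idfun R})
  (ip_norm : forall x : X, ip x x = `|x| ^+ 2)
  (X_separable : separable_space X)
  (U : R -> R -> X -> X) (B : R -> X -> X)
  (A1 : evolution_operator U)
  (A2_op : forall t, bounded_op (B t))
  (A2_sup : (ereal_sup (range (fun t => opnorm (B t))) < +oo)%E)
  (A2_meas : strongly_measurable B)
  (A3 : forall s t, s < t -> (op_trace ip (Qfin ip U B t s) < +oo)%E)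
  (A4_sup : forall t,
    (ereal_sup [set op_trace ip (Qfin ip U B t s) | s in [set s : R | (s < t)%R]] < +oo)%E)
  (A4_lim : forall t (x : X), U t s x @[s --> -oo] --> (0 : X))
  (s t : R) (st : s < t) :
  let Qts := Qfin ip U B t s in
  let Qt := Qinf ip U B t in
  let Qs := Qinf ip U B s in
  let normU := opnorm_on (cm_space ip Qs) (cm_norm ip Qs) (cm_norm ip Qt) (U t s) in
  let normC := opnorm (pseudo_inv ip (sqrt_op ip Qt) \o U t s \o sqrt_op ip Qs) in
  [/\ [/\ cm_space ip Qts `<=` cm_space ip Qt,
          (opnorm_on (cm_space ip Qts) (cm_norm ip Qts) (cm_norm ip Qt) id <= 1)%E,
          op_ker (sqrt_op ip Qt) `<=` op_ker (sqrt_op ip Qts)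
        & strongly_continuous B ->
          op_ker (sqrt_op ip Qts) `<=` op_ker (Qop ip B t)],
      [/\ forall h, cm_space ip Qs h -> cm_space ip Qt (U t s h),
          normU = normC
        & (normC <= 1)%E]
    & cm_space ip Qt `<=` cm_space ip Qts <-> normU = normC /\ (normC < 1)%E].
Proof.
have [e eP e_trace] := basis_seq_trace ip ip_norm X_separable.
have Qinf_sa u := (Qinf_form ip ip_norm e eP X_separable U B A1 A2_op A2_sup
  A2_meas A4_sup e_trace u).2.
have Qts_sa := (Qfin_form ip ip_norm e eP X_separable U B A1 A2_op A2_sup
  A2_meas st).2.
have decomposition := fun x => Qinf_sqrt_decomposition ip ip_norm e eP X_separable U B
  A1 A2_op A2_sup A2_meas A4_sup e_trace s t x st.
have U_bounded := U_bounded U A1 (ltW st).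
have U_adj := op_adjointP ip ip_norm U_bounded.
have [U_lin _] := U_bounded.
move=> Qts Qt Qs normU normC.
have [St_sa _] := sqrt_opP ip ip_norm Qt (Qinf_sa t).
have [Ss_sa _] := sqrt_opP ip ip_norm Qs (Qinf_sa s).
have [Sts_sa StsE] := sqrt_opP ip ip_norm Qts Qts_sa.
have normE : normU = normC by exact: opnorm_conj.
split; first split.
- exact: (range_sub_of_decomposition ip ip_norm St_sa Sts_sa decomposition).
- exact: (opnorm_embedding_le1 ip ip_norm St_sa Sts_sa decomposition).
- exact: (kernel_sub_of_decomposition decomposition).
- move=> Bc x Sx; apply: (Qfin_kernel ip ip_norm e eP X_separable U B A1 A2_op
    A2_sup A2_meas s t x st Bc).
  rewrite -/Qts -StsE Sx lin0 ?ip0l//; by case: Sts_sa => -[].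
- split=> //.
    exact: (range_image_of_decomposition ip ip_norm St_sa Ss_sa U_adj decomposition).
  exact: (opnorm_conj_le1 ip ip_norm St_sa Ss_sa U_adj decomposition).
split=> [h|[_ h]].
  split=> //.
  exact: (range_opnorm_lt1 ip ip_norm St_sa Sts_sa Ss_sa U_adj decomposition h).
exact: (opnorm_lt1_range ip ip_norm St_sa Sts_sa Ss_sa U_adj U_lin decomposition h).
Qed.
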